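(* For a sequence ${\boldsymbol{\alpha}}=(\alpha_2,\alpha_3,\ldots)$ of nonnegative integers with finitely many nonzero entries, let $\widetilde{H}({\boldsymbol{\alpha}})$ denote the number of equivalence classes of minimal factorizations of type ${\boldsymbol{\alpha}}$ of the $n$-cycle $(1\,2\,\ldots\,n)$, where $n=1+\langle{\boldsymbol{\alpha}}\rangle$ (with $\widetilde{H}(\boldsymbol{0})=1$). Then the formal power series $$\xi(\boldsymbol{x})=\sum_{{\boldsymbol{\alpha}}}\widetilde{H}({\boldsymbol{\alpha}})\,x_2^{\alpha_2}x_3^{\alpha_3}\cdots,$$ with the sum over all such ${\boldsymbol{\alpha}}$, satisfies $$\xi(\boldsymbol{x})=1+x_2\,\xi(\boldsymbol{x})^3+x_3\,\xi(\boldsymbol{x})^5+\cdots=1+\sum_{j\ge2}x_j\,\xi(\boldsymbol{x})^{2j-1}.$$ Consequently, for every $n\ge 0$, $$\sum_{{\boldsymbol{\alpha}}:\,\langle{\boldsymbol{\alpha}}\rangle=n}(-1)^{|{\boldsymbol{\alpha}}|+n}\,\widetilde{H}({\boldsymbol{\alpha}})=\frac{1}{n+1}\binom{2n}{n},$$ the $n$-th Catalan number.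
   Context: For ${\boldsymbol{\alpha}}=(\alpha_2,\alpha_3,\ldots)$, $|{\boldsymbol{\alpha}}|=\sum_{j\ge2}\alpha_j$ and $\langle{\boldsymbol{\alpha}}\rangle=\sum_{j\ge2}(j-1)\alpha_j$. Permutations are multiplied right to left. A factorization of $(1\,2\,\ldots\,n)$ is an expression $(1\,2\,\ldots\,n)=\sigma_m\cdots\sigma_1$ with each $\sigma_i$ a cycle of length at least $2$; it has type ${\boldsymbol{\alpha}}$ if exactly $\alpha_j$ factors are $j$-cycles, and it is minimal if $\langle{\boldsymbol{\alpha}}\rangle=n-1$. Two factorizations are equivalent if they differ only in the order of commuting factors (one is obtained from the other by repeatedly swapping adjacent commuting factors). *)

(* Defs.v *)
From HB Require Import structures.
From mathcomp Require Import all_boot all_order all_algebra all_fingroup.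
From mathcomp Require Import mpoly.

Set Implicit Arguments.
Unset Strict Implicit.
Unset Printing Implicit Defensive.

Import GRing.Theory.

Definition ncycle (n : nat) : {perm 'I_n} := perm (@ordS_inj n).

Definition is_kcycle (T : finType) (k : nat) (s : {perm T}) : bool :=
  (2 <= k) &&
  [exists x, (#|porbit s x| == k) &&
             [forall y, (y \notin porbit s x) ==> (s y == y)]].

(* A monomial m in N variables encodes the type alpha with
   alpha_j = m (j-2) for 2 <= j <= N+1 (variable i <-> x_{i+2}),
   and alpha_j = 0 otherwise. *)
Definition alpha_of (N : nat) (m : 'X_{1..N}) (j : nat) : nat :=
  if j < 2 then 0%N
  else if (insub (j - 2) : option 'I_N) is Some i then m i else 0%N.

(* <alpha> = sum_j (j-1) alpha_j ; |alpha| is mdeg m. *)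
Definition weight (N : nat) (m : 'X_{1..N}) : nat :=
  (\sum_(i < N) i.+1 * m i)%N.

(* t = (sigma_1, ..., sigma_M) is a factorization of (1 2 ... n) of type a:
   sigma_M ... sigma_1 = (1 ... n) (right-to-left product; in MathComp
   (s * t) x = t (s x), so this is the left-to-right MathComp product
   sigma_1 * ... * sigma_M), every factor is a cycle of length >= 2, and
   exactly a j factors are j-cycles. *)
Definition is_fact (n M : nat) (a : nat -> nat)
    (t : M.-tuple {perm 'I_n}) : bool :=
  [&& ((\prod_(i < M) tnth t i)%g == ncycle n),
      [forall i : 'I_M, exists k : 'I_n.+1, is_kcycle k (tnth t i)] &
      [forall k : 'I_n.+1, count (is_kcycle k) t == a k]].

Definition swap_rel (n M : nat) : rel (M.-tuple {perm 'I_n}) :=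
  fun t t' =>
    [exists k : 'I_M, exists k' : 'I_M,
      [&& (val k' == (val k).+1),
          ((tnth t k * tnth t k')%g == (tnth t k' * tnth t k)%g) &
          [forall i : 'I_M, tnth t' i == tnth t (tperm k k' i)]]].

Definition Htilde (N : nat) (m : 'X_{1..N}) : nat :=
  let n := (weight m).+1 in
  let M := mdeg m in
  #|equivalence_partition (connect (@swap_rel n M))
      [set t : M.-tuple {perm 'I_n} | is_fact (alpha_of m) t]|.

Definition xi_trunc (N d : nat) : {mpoly int[N]} :=
  \sum_(m : 'X_{1..N < d.+1}) ((Htilde m)%:R : int) *: 'X_[(m : 'X_{1..N})].

(* Main.v *)
From HB Require Import structures.
Require Import Defs.
From mathcomp Require Import all_boot all_order all_algebra all_fingroup.
From mathcomp Require Import mpoly zify ring.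

(* Read a factor sequence from left to right.  An equivalence class of minimal
   factorizations of a cycle [(l_0 l_1 ... l_r)] is encoded by a plane tree: the
   root is the last factor [s = (v_1 ... v_j)] moving [v_1 = l_0]; the factors
   hanging from [v_i] that must precede [s] form a minimal factorization of the
   cycle on an interval starting at [v_i], those that must follow [s] (none
   for [i = 1]) one on an interval ending at [v_i], and these [2 j - 1]
   intervals cover the list.  This is the equation
   [xi = 1 + sum_j x_j xi^(2 j - 1)].

   Every minimal factorization is equivalent to the word of a tree: let [s] be
   its last factor.  Giving two points the same label when some earlier factor
   moves both, minimality forces the points of [s] to have distinct labels, so
   [s] is increasing and the earlier factors split into commuting minimal
   factorizations of the arcs that [s] cuts out of the cycle.  By induction each
   of them is the word of a tree, and [s] together with the other arcs is
   inserted into the tree of the arc through [l_0].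

   Different trees give inequivalent words, because the tree can be read off the
   set of factors.

   For the signed sum, the number of forests of [k] trees of given type
   satisfies [F_(k+1) = F_k + sum_j x_j F_(k+2j-1)]; summing with signs and
   telescoping leaves [G_(k+1)(n) = G_k(n) + G_(k+2)(n-1)], the recursion of the
   ballot numbers. *)

Set Implicit Arguments.
Unset Strict Implicit.
Unset Printing Implicit Defensive.

(** * Multiplicities as a test for duplicate-free lists *)

Section UniqCount.
Variable X : eqType.
Implicit Types (s t : seq X) (z : X).

Lemma uniq_count s z : uniq s -> count_mem z s <= 1.
Proof. by move/count_uniq_mem->; case: (_ \in _). Qed.

Lemma count_le1_uniq s : (forall z, count_mem z s <= 1) -> uniq s.
Proof.
move=> h; apply: count_mem_uniq => z; have := h z.
have [zs|/count_memPn-> //] := boolP (z \in s).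
by move: zs; rewrite -has_pred1 has_count; case: (count_mem z s) => [|[|]].
Qed.

Lemma mem_count s z : (z \in s) = (0 < count_mem z s).
Proof. by rewrite -has_pred1 has_count. Qed.

(** Blocks and rearrangements of a duplicate-free list all reduce to this pointwise comparison,
    which is linear arithmetic; [uniq_by] automates it. *)
Lemma uniq_subcount s t : uniq s ->
  (forall z, count_mem z t <= count_mem z s) -> uniq t.
Proof.
by move=> us h; apply: count_le1_uniq => z; apply: leq_trans (h z) (uniq_count z us).
Qed.

End UniqCount.

Ltac clear_all := repeat match goal with H : _ |- _ => clear H end.
Ltac count_lia := do 4 (rewrite /= ?count_cat /=); clear_all; lia.
Ltac uniq_by u := apply: (uniq_subcount u) => ?; count_lia.

(** * Cycles written as lists of points *)

Section Cyc.
Local Open Scope group_scope.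
Variable X : finType.
Implicit Types (l s A B P Q : seq X) (x y z v : X).

(** A star of transpositions through the first point, so that gluing two cycles at a common first
    point is a concatenation. Multiplied from left to right, it sends each point to its successor in
    the list. *)
Definition cyc (l : seq X) : {perm X} :=
  if l is x :: s then \prod_(y <- s) tperm x y else 1.

Arguments cyc : simpl never.

Definition supp (p : {perm X}) : {set X} := [set x | p x != x].

Lemma next_notin l z : z \notin l -> next l z = z.
Proof. by move=> zl; rewrite next_nth (negPf zl). Qed.

Lemma cycE l z : uniq l -> cyc l z = next l z.
Proof.
case: l => [|x s]; first by rewrite perm1.
rewrite /cyc; elim: s z => [|y s IHs] z.
  by rewrite big_nil perm1 /=; case: eqP.
rewrite big_cons permM cons_uniq inE negb_or -andbA => /and3P[xy xs /andP[ys us]].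
rewrite IHs; last by rewrite cons_uniq xs.
have [->|zx] := eqVneq z x.
  by rewrite tpermL next_notin /= ?eqxx // inE negb_or eq_sym xy.
have [->|zy] := eqVneq z y.
  rewrite tpermR /= eq_sym (negPf xy).
  by case: s {IHs xs ys us} => [|y' s]; rewrite /= !eqxx.
rewrite tpermD 1?eq_sym //= (negPf zx).
by case: s {IHs xs ys us} => [|y' s] /=; rewrite ?(negPf zy) ?(negPf zx).
Qed.

Lemma cyc_out l z : uniq l -> z \notin l -> cyc l z = z.
Proof. by move=> ul zl; rewrite cycE // next_notin. Qed.

Lemma cyc_rot A B : uniq (A ++ B) -> cyc (B ++ A) = cyc (A ++ B).
Proof.
move=> u; apply/permP=> z; rewrite !cycE //; last by rewrite uniq_catC.
by rewrite -rot_size_cat next_rot.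
Qed.

Lemma cyc_step P Q x y : uniq (P ++ x :: y :: Q) -> cyc (P ++ x :: y :: Q) x = y.
Proof.
move=> u; rewrite -cyc_rot // cycE; last by rewrite uniq_catC.
by rewrite /= eqxx.
Qed.

Lemma cyc_in l z : uniq l -> (cyc l z \in l) = (z \in l).
Proof. by move=> ul; rewrite cycE // mem_next. Qed.

Lemma supp_cycS l : uniq l -> {subset supp (cyc l) <= l}.
Proof. by move=> ul z; rewrite inE; apply: contraNT => /(cyc_out ul)->. Qed.

Lemma supp_cyc l : uniq l -> 1 < size l -> supp (cyc l) =i l.
Proof.
move=> ul sl z; apply/idP/idP => [|zl]; first exact: supp_cycS.
rewrite inE; case/splitPr: zl ul sl => P Q u sl; rewrite -cyc_rot //.
have : size (Q ++ P) != 0 by move: sl; rewrite !size_cat /=; lia.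
have := u; rewrite uniq_catC cat_cons; case: (Q ++ P) => [//|y s] u2 _.
have /= -> := @cyc_step [::] s z y u2.
by move: u2; rewrite /= inE negb_or eq_sym -andbA => /and3P[].
Qed.

Lemma cyc_glue x A B : cyc (x :: A) * cyc (x :: B) = cyc (x :: A ++ B).
Proof. by rewrite /cyc big_cat. Qed.

(** Rotate so that [v] leads both cycles. A factor placed before the cycle inserts its points just
    after [v]. *)
Lemma cyc_glueA P v A Q : uniq (P ++ v :: A ++ Q) ->
  cyc (v :: A) * cyc (P ++ v :: Q) = cyc (P ++ v :: A ++ Q).
Proof.
move=> u; rewrite -cyc_rot; last by uniq_by u.
rewrite cat_cons cyc_glue -[in RHS]cyc_rot // cat_cons catA.
by [].
Qed.

(** A factor placed after the cycle inserts its points just before [v]. This explains the two kinds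
    of intervals, those starting and those ending at a point of the root cycle. *)
Lemma cyc_glueB P v B Q : uniq (P ++ B ++ v :: Q) ->
  cyc (P ++ v :: Q) * cyc (B ++ [:: v]) = cyc (P ++ B ++ v :: Q).
Proof.
move=> u; rewrite -(@cyc_rot P); last by uniq_by u.
rewrite -(@cyc_rot B); last by uniq_by u.
rewrite cat_cons cyc_glue catA -[in RHS]cyc_rot; last by uniq_by u.
by rewrite -!catA.
Qed.

(** Follow both cycles from [x], carrying the common prefix [p] already visited. *)
Lemma cyc_head_inj x s s' : uniq (x :: s) -> uniq (x :: s') ->
  cyc (x :: s) = cyc (x :: s') -> s = s'.
Proof.
suff h t t' p : uniq (x :: p ++ t) -> uniq (x :: p ++ t') ->
  cyc (x :: p ++ t) = cyc (x :: p ++ t') -> t = t' by exact: (h _ _ [::]).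
have E q : exists l y, x :: q = l ++ [:: y].
  by case/lastP: q => [|q y]; [exists [::], x | exists (x :: q), y; rewrite cats1].
(* If one list stops first, the cycles disagree at its last point: one stays inside the short list,
   the other moves on to [a]. *)
have N q a r : uniq (x :: q ++ a :: r) -> cyc (x :: q) <> cyc (x :: q ++ a :: r).
  move=> u eqc; have [l [y El]] := E q.
  have := congr1 (fun c : {perm X} => c y) eqc.
  rewrite -!cat_cons El -catA cat1s cyc_step -?El; last first.
    by move: u; rewrite -cat_cons El -catA.
  move=> h; have: a \in l ++ [:: y].
    rewrite -El -h cyc_in El ?mem_cat ?inE ?eqxx ?orbT // -El.
    by uniq_by u.
  by move: (uniq_count a u); rewrite -cat_cons El mem_count !count_cat /= eqxx; lia.
elim: t t' p => [|a t IH] [|b t'] p u u' // eqc.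
- by rewrite cats0 in eqc; have := N _ _ _ u' eqc.
- by rewrite cats0 in eqc; have := N _ _ _ u (esym eqc).
have [l [y El]] := E p.
have ab : a = b.
  have := congr1 (fun c : {perm X} => c y) eqc.
  rewrite -!cat_cons El -!catA !cat1s !cyc_step //.
  - by move: u'; rewrite -cat_cons El -catA.
  - by move: u; rewrite -cat_cons El -catA.
rewrite -ab in u' eqc *; congr (_ :: _); apply: (IH _ (rcons p a)); rewrite !cat_rcons //.
Qed.

End Cyc.

Arguments cyc {X} l : simpl never.

(** * Commutation equivalence *)

Section Ceq.
Local Open Scope group_scope.
Variable gT : finGroupType.
Implicit Types (t u p q : seq gT).

(** Lists of any length can be cut and concatenated freely, unlike the tuples of [swap_rel];
    [ceq_connect] goes back to tuples. *)
Inductive ceq t : seq gT -> Prop :=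
| ceq_refl : ceq t t
| ceq_step p a b q :
    ceq t (p ++ a :: b :: q) -> commute a b -> ceq t (p ++ b :: a :: q).

Lemma ceq_trans u t v : ceq t u -> ceq u v -> ceq t v.
Proof.
move=> tu; elim=> {v} // p a b q _ IH ab; exact: ceq_step IH ab.
Qed.

Lemma ceq_catl p t u : ceq t u -> ceq (p ++ t) (p ++ u).
Proof.
elim=> {u} [|r a b q _ IH ab]; first exact: ceq_refl.
by rewrite catA; apply: ceq_step ab; rewrite -catA.
Qed.

Lemma ceq_catr q t u : ceq t u -> ceq (t ++ q) (u ++ q).
Proof.
elim=> {u} [|r a b p _ IH ab]; first exact: ceq_refl.
by rewrite -catA; apply: ceq_step ab; rewrite -catA in IH.
Qed.

Lemma ceq_cat t u p q : ceq t u -> ceq p q -> ceq (t ++ p) (u ++ q).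
Proof. by move=> tu pq; apply: ceq_trans (ceq_catr _ tu) (ceq_catl _ pq). Qed.

Lemma ceq_perm t u : ceq t u -> perm_eq t u.
Proof.
elim=> {u} // p a b q _ IH _; apply: perm_trans IH _.
by rewrite perm_cat2l -[_ :: _ :: _](cat1s a) -[b :: _](cat1s b) -[X in perm_eq _ X](cat1s b) -[a :: _](cat1s a) perm_catCA.
Qed.

Lemma ceq_comm t u : (forall a b, a \in t -> b \in u -> commute a b) ->
  ceq (t ++ u) (u ++ t).
Proof.
elim: t => [|a t IHt] h; first by rewrite cats0; apply: ceq_refl.
apply: (@ceq_trans (a :: u ++ t)).
  by apply: (ceq_catl [:: a]); apply: IHt => b c bt; apply: h; rewrite inE bt orbT.
have {}h b : b \in u -> commute a b by apply: h; rewrite mem_head.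
elim: u h {IHt} => [|b u IHu] h; first exact: ceq_refl.
apply: (@ceq_trans (b :: a :: u ++ t)).
  by apply: (@ceq_step _ [::]); [apply: ceq_refl | apply: h; rewrite mem_head].
by apply: (ceq_catl [:: b]); apply: IHu => c cu; apply: h; rewrite inE cu orbT.
Qed.

End Ceq.

(** * Trees and their words *)

(* [Node a c] carries a [j]-cycle [(v_1 ... v_j)], where [a] hangs from [v_1]
   and [c] lists, for [i = 2, ..., j], the trees [b] and [a] whose intervals
   respectively end and start at [v_i]. *)
Inductive tree := Leaf | Node of tree & chain
with chain := Nil | Cons of tree & tree & chain.

Definition isCons c := if c is Cons _ _ _ then true else false.

Fixpoint tree_wf T := if T is Node a c then [&& isCons c, tree_wf a & chain_wf c] else true
with chain_wf c :=
  if c is Cons b a c then [&& tree_wf b, tree_wf a & chain_wf c] else true.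

(** A [j]-cycle contributes [j - 1], so this is the weight of the type of the tree, and the list
    below the tree has one more point. *)
Fixpoint tree_size T := if T is Node a c then tree_size a + chain_size c else 0
with chain_size c :=
  if c is Cons b a c then (tree_size b + tree_size a + chain_size c).+1 else 0.

Fixpoint chain_len c := if c is Cons _ _ c then (chain_len c).+1 else 0.

Fixpoint tree_cnt j T :=
  if T is Node a c then (j == (chain_len c).+1) + tree_cnt j a + chain_cnt j c else 0
with chain_cnt j c :=
  if c is Cons b a c then tree_cnt j b + tree_cnt j a + chain_cnt j c else 0.

Scheme tree_chain_ind := Induction for tree Sort Prop
with chain_tree_ind := Induction for chain Sort Prop.
Combined Scheme tree_mutind from tree_chain_ind, chain_tree_ind.

Section NF.
Local Open Scope group_scope.
Variable X : finType.
Implicit Types (x y z v : X) (A B L P Q vs : seq X) (w : seq {perm X}).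
Implicit Types (T a b : tree) (c : chain) (s : {perm X}).

Notation pr w := (\prod_(s <- w) s).

(* [nf T L w]: on the list of points [L], the tree [T] has the word [w].  In
   [nfc c L vs As Bs], [vs] lists the points of the root cycle lying in [L], and
   [As] (resp. [Bs]) the factors that come before (resp. after) that cycle. *)
Inductive nf : tree -> seq X -> seq {perm X} -> Prop :=
| nfLeaf x : nf Leaf [:: x] [::]
| nfNode a c x A L vs w As Bs :
    isCons c -> nf a (x :: A) w -> nfc c L vs As Bs ->
    nf (Node a c) (x :: A ++ L) (w ++ As ++ cyc (x :: vs) :: Bs)
with nfc : chain -> seq X -> seq X -> seq {perm X} -> seq {perm X} -> Prop :=
| nfNil : nfc Nil [::] [::] [::] [::]
| nfCons b a c B v A L vs wb wa As Bs :
    nf b (B ++ [:: v]) wb -> nf a (v :: A) wa -> nfc c L vs As Bs ->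
    nfc (Cons b a c) (B ++ v :: A ++ L) (v :: vs) (wa ++ As) (Bs ++ wb).

Scheme nf_indm := Minimality for nf Sort Prop
with nfc_indm := Minimality for nfc Sort Prop.
Combined Scheme nf_mutind from nf_indm, nfc_indm.

(** The sizes of the subtrees dictate where the list is cut. *)
Lemma nf_ex_mut :
  (forall T, tree_wf T -> forall L, size L = (tree_size T).+1 -> exists w, nf T L w) /\
  (forall c, chain_wf c -> forall L, size L = chain_size c ->
     exists vs As Bs, nfc c L vs As Bs).
Proof.
apply: tree_mutind => [_ [|x [|//]] // _|a IHa c IHc|_ [|//] _|b IHb a IHa c IHc].
- by exists [::]; apply: nfLeaf.
- case/and3P=> c0 wa wc [|x L] //= [sL].
  have [|w hw] := IHa wa (x :: take (tree_size a) L).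
    by rewrite /= size_take; move: sL; case: ltnP; lia.
  have [|vs [As [Bs hc]]] := IHc wc (drop (tree_size a) L).
    by rewrite size_drop; lia.
  exists (w ++ As ++ cyc (x :: vs) :: Bs).
  by rewrite -[L](cat_take_drop (tree_size a)); apply: nfNode.
- by exists [::], [::], [::]; apply: nfNil.
case/and3P=> wb wa wc L /= sL.
have := cat_take_drop (tree_size b) L.
case E: (drop _ L) => [|v L1] EL.
  by have := congr1 size E; rewrite size_drop /=; lia.
have sL1 : size L1 = tree_size a + chain_size c.
  by have := congr1 size E; rewrite size_drop /=; lia.
have [|wb' hb] := IHb wb (take (tree_size b) L ++ [:: v]).
  by rewrite size_cat size_take /=; case: ltnP; lia.
have [|wa' ha] := IHa wa (v :: take (tree_size a) L1).
  by rewrite /= size_take; case: ltnP; lia.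
have [|vs [As [Bs hc]]] := IHc wc (drop (tree_size a) L1).
  by rewrite size_drop; lia.
exists (v :: vs), (wa' ++ As), (Bs ++ wb').
by rewrite -EL -[L1](cat_take_drop (tree_size a)); apply: nfCons.
Qed.

Lemma nf_ex T L : tree_wf T -> size L = (tree_size T).+1 -> exists w, nf T L w.
Proof. by move=> wT; apply: nf_ex_mut.1. Qed.

Lemma nf_size_mut :
  (forall T L w, nf T L w -> size L = (tree_size T).+1) /\
  (forall c L vs As Bs, nfc c L vs As Bs ->
     size L = chain_size c /\ size vs = chain_len c).
Proof.
apply: nf_mutind => // [a c x A L vs w As Bs _ _ IH _ []|
  b a c B v A L vs wb wa As Bs _ IHb _ IHa _ []].
- by move: IH; rewrite /= size_cat; lia.
by move=> sL svs; move: IHa IHb; rewrite !size_cat /= size_cat; split; lia.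
Qed.

Lemma nfc_isCons c L vs As Bs : nfc c L vs As Bs -> isCons c = (0 < size vs).
Proof. by case. Qed.

Lemma nfc_sub c L vs As Bs : nfc c L vs As Bs ->
  forall z, count_mem z vs <= count_mem z L.
Proof.
elim=> {c L vs As Bs} // b a c B v A L vs wb wa As Bs _ _ _ IH z.
by have := IH z; rewrite !count_cat /= count_cat; lia.
Qed.

(** The lower bound on supports serves to locate a factor: it cannot live on two lists that share a
    single point. *)
Definition on (A : seq X) w :=
  forall s, s \in w -> 1 < #|supp s| /\ {subset supp s <= A}.

Lemma on_sub A B w : {subset A <= B} -> on A w -> on B w.
Proof. by move=> AB h s /h[? sA]; split=> // z /sA/AB. Qed.

Lemma on_cat A w w' : on A (w ++ w') <-> on A w /\ on A w'.
Proof.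
split=> [h|[h h'] s]; last by rewrite mem_cat => /orP[/h|/h'].
by split=> s sw; apply: h; rewrite mem_cat sw ?orbT.
Qed.

Lemma on_cons A s w : on A (s :: w) <-> on A [:: s] /\ on A w.
Proof. exact: (on_cat A [:: s]). Qed.

Lemma card_supp_cyc L : uniq L -> 1 < size L -> #|supp (cyc L)| = size L.
Proof.
by move=> uL sL; rewrite -(card_uniqP uL); apply: eq_card; apply: supp_cyc.
Qed.

Lemma on_cyc A L : uniq L -> 1 < size L -> {subset L <= A} -> on A [:: cyc L].
Proof.
move=> uL sL LA s; rewrite inE => /eqP->; rewrite card_supp_cyc //.
by split=> // z; rewrite supp_cyc // => /LA.
Qed.

Lemma count_subset A B : (forall z, count_mem z A <= count_mem z B) -> {subset A <= B}.
Proof. by move=> h z; rewrite !mem_count => zA; apply: leq_trans zA (h z). Qed.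

Lemma nf_on_mut :
  (forall T L w, nf T L w -> uniq L -> on L w) /\
  (forall c L vs As Bs, nfc c L vs As Bs -> uniq L -> on L As /\ on L Bs).
Proof.
apply: nf_mutind => // [a c x A L vs w As Bs c0 _ IHa hc IHc u|
  b a c B v A L vs wb wa As Bs _ IHb _ IHa _ IHc u].
- have [|hA hB] := IHc; first by uniq_by u.
  have vL := nfc_sub hc.
  have subL : {subset L <= x :: A ++ L}.
    by apply: count_subset => z; count_lia.
  have {IHa}ha : on (x :: A) w by apply: IHa; uniq_by u.
  rewrite !on_cat on_cons; split; [|split; [|split]].
  + apply: on_sub ha; apply: count_subset => z; count_lia.
  + exact: on_sub hA.
  + apply: on_cyc.
    * apply: (uniq_subcount u) => z; have := vL z; count_lia.
    * by rewrite /= ltnS -(nfc_isCons hc).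
    * by apply: count_subset => z; have := vL z; count_lia.
  + exact: on_sub hB.
have [|hA hB] := IHc; first by uniq_by u.
have {IHa}ha : on (v :: A) wa by apply: IHa; uniq_by u.
have {IHb}hb : on (B ++ [:: v]) wb by apply: IHb; uniq_by u.
have sub D : (forall z, count_mem z D <= count_mem z (B ++ v :: A ++ L)) ->
    forall w, on D w -> on (B ++ v :: A ++ L) w.
  by move=> h w; apply: on_sub; apply: count_subset.
by rewrite !on_cat; split; split; [apply: sub ha|apply: sub hA|apply: sub hB|apply: sub hb];
  move=> z; count_lia.
Qed.

Lemma nf_on T L w : nf T L w -> uniq L -> on L w.
Proof. exact: nf_on_mut.1. Qed.

Lemma nfc_on c L vs As Bs : nfc c L vs As Bs -> uniq L -> on L As /\ on L Bs.
Proof. exact: nf_on_mut.2. Qed.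

(** For a chain, [P] is the stretch of the list to the left of [L], starting as [[:: x]] at a node.
    The induction hypothesis is used with [v] appended to [P]; then [cyc_glueA] inserts [A] after
    [v] and [cyc_glueB] inserts [B] before it. *)
Lemma nf_prod_mut :
  (forall T L w, nf T L w -> uniq L -> pr w = cyc L) /\
  (forall c L vs As Bs, nfc c L vs As Bs -> forall P, uniq (P ++ L) ->
     pr As * cyc (P ++ vs) * pr Bs = cyc (P ++ L)).
Proof.
apply: nf_mutind => [x _|a c x A L vs w As Bs c0 _ IHa hc IHc u|P|
  b a c B v A L vs wb wa As Bs _ IHb _ IHa hc IHc P u].
- by rewrite big_nil /cyc big_nil.
- rewrite !big_cat big_cons /= (mulgA (pr As)) (IHc [:: x]); last by uniq_by u.
  rewrite IHa; last by uniq_by u.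
  by rewrite (cyc_glueA (P := [::])).
- by rewrite !big_nil mulg1 mul1g.
rewrite !big_cat IHb; last by uniq_by u.
rewrite IHa; last by uniq_by u.
have := IHc (P ++ [:: v]); rewrite -!catA !cat1s => E.
rewrite -!mulgA (mulgA _ (pr Bs)) (mulgA (pr As)) (mulgA (pr As)) E; last by uniq_by u.
rewrite mulgA cyc_glueA; last by uniq_by u.
by rewrite cyc_glueB.
Qed.

Lemma nf_prod T L w : nf T L w -> uniq L -> pr w = cyc L.
Proof. exact: nf_prod_mut.1. Qed.

Lemma nf_card_mut :
  (forall T L w, nf T L w -> uniq L ->
     forall j, count (fun s => #|supp s| == j) w = tree_cnt j T) /\
  (forall c L vs As Bs, nfc c L vs As Bs -> uniq L ->
     forall j, count (fun s => #|supp s| == j) (As ++ Bs) = chain_cnt j c).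
Proof.
apply: nf_mutind => [x _|a c x A L vs w As Bs c0 _ IHa hc IHc u|P|
  b a c B v A L vs wb wa As Bs _ IHb _ IHa hc IHc u] j //.
- rewrite !count_cat /= IHa; last by uniq_by u.
  rewrite -IHc; last by uniq_by u.
  have uv : uniq (x :: vs).
    by apply: (uniq_subcount u) => z; have := nfc_sub hc z; count_lia.
  rewrite count_cat card_supp_cyc //=; last by rewrite ltnS -(nfc_isCons hc).
  by rewrite (nf_size_mut.2 _ _ _ _ _ hc).2 (eq_sym j); lia.
rewrite /= -IHc; last by uniq_by u.
rewrite -IHa; last by uniq_by u.
rewrite -IHb; last by uniq_by u.
by rewrite !count_cat; lia.
Qed.

Lemma nf_card T L w : nf T L w -> uniq L ->
  forall j, count (fun s => #|supp s| == j) w = tree_cnt j T.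
Proof. exact: nf_card_mut.1. Qed.

Lemma nf_cyc_mut :
  (forall T L w, nf T L w -> uniq L ->
     forall s, s \in w -> exists l, [/\ uniq l, 1 < size l & s = cyc l]) /\
  (forall c L vs As Bs, nfc c L vs As Bs -> uniq L ->
     forall s, s \in As ++ Bs -> exists l, [/\ uniq l, 1 < size l & s = cyc l]).
Proof.
apply: nf_mutind => [x _|a c x A L vs w As Bs c0 _ IHa hc IHc u|P|
  b a c B v A L vs wb wa As Bs _ IHb _ IHa hc IHc u] s //.
- have [|] := boolP (s \in w); first by move=> sw _; apply: IHa => //; uniq_by u.
  have [|] := boolP (s \in As ++ Bs); first by move=> sw *; apply: IHc => //; uniq_by u.
  rewrite !mem_cat inE => /norP[/negPf-> /negPf->] /negPf->.
  rewrite orbF => /eqP->; exists (x :: vs); split=> //.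
  + apply: (uniq_subcount u) => z; have := nfc_sub hc z; count_lia.
  + by rewrite /= ltnS -(nfc_isCons hc).
have [sw _|] := boolP (s \in wa); first by apply: IHa => //; uniq_by u.
have [sw *|] := boolP (s \in wb); first by apply: IHb => //; uniq_by u.
rewrite !mem_cat => /negPf-> /negPf->; rewrite orbF -mem_cat => sw.
by apply: IHc => //; uniq_by u.
Qed.

Lemma nf_cyc T L w s : nf T L w -> uniq L -> s \in w ->
  exists l, [/\ uniq l, 1 < size l & s = cyc l].
Proof. by move=> h uL; apply: (nf_cyc_mut.1 _ _ _ h uL). Qed.

End NF.

(** * Recovering the tree from the set of factors *)

Section Inj.
Local Open Scope group_scope.
Variable X : finType.
Implicit Types (x y z v : X) (A B L P Q vs : seq X) (w : seq {perm X}).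
Implicit Types (T a b : tree) (c : chain) (s : {perm X}).

Notation pr w := (\prod_(s <- w) s).

Lemma nf_nodeE T x L w : nf T (x :: L) w -> L != [::] ->
  exists a c A L1 vs wa As Bs,
   [/\ T = Node a c, L = A ++ L1, w = wa ++ As ++ cyc (x :: vs) :: Bs &
     [/\ isCons c, nf a (x :: A) wa & nfc c L1 vs As Bs]].
Proof.
move=> h; inversion h; subst => // _; do 8 eexists; split; by [eauto | split; eauto].
Qed.

Lemma nf_leafE T L w : nf T L w -> size L = 1%N -> T = Leaf.
Proof.
case=> // a c x A L' vs wa As Bs c0 _ hc /=; rewrite size_cat => -[].
have := nf_size_mut X => -[_ /(_ _ _ _ _ _ hc)[-> _]].
by case: (c) c0 => //= b' a' c' _; lia.
Qed.

Lemma nfc_consE c L v vs As Bs : nfc c L (v :: vs) As Bs ->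
  exists b a c1 B A L1 wb wa As1 Bs1,
   [/\ c = Cons b a c1, L = B ++ v :: A ++ L1, As = wa ++ As1, Bs = Bs1 ++ wb &
     [/\ nf b (B ++ [:: v]) wb, nf a (v :: A) wa & nfc c1 L1 vs As1 Bs1]].
Proof.
move=> h; inversion h; subst; do 10 eexists; split; by [eauto | split; eauto].
Qed.

Lemma uniq_split v B B' Q Q' : uniq (B ++ v :: Q) ->
  B ++ v :: Q = B' ++ v :: Q' -> B = B' /\ Q = Q'.
Proof.
move=> u e; have u' := u; rewrite e in u'.
have i R S : uniq (R ++ v :: S) -> index v (R ++ v :: S) = size R.
  move=> uu; have := uniq_count v uu; rewrite count_cat /= eqxx index_cat /= eqxx addn0.
  by rewrite mem_count; case: (count_mem v R) => [//|n]; lia.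
have sB : size B = size B' by rewrite -(i _ _ u) -(i _ _ u') e.
by move/eqP: e; rewrite eqseq_cat // => /andP[/eqP-> /eqP[->]].
Qed.

Lemma cat_cut A A' L L' : size A <= size A' -> A ++ L = A' ++ L' ->
  exists C, A' = A ++ C /\ L = C ++ L'.
Proof.
move=> sA e; exists (drop (size A) A'); have := congr1 (take (size A)) e.
have := congr1 (drop (size A)) e.
rewrite !take_cat !drop_cat ltnn subnn take0 drop0 cats0.
case: ltnP => h.
  by move=> eL eA; rewrite -{1}(cat_take_drop (size A) A') -eA.
have -> : size A = size A' by apply/eqP; rewrite eqn_leq sA.
by rewrite subnn take0 drop0 drop_size !cats0 => -> ->.
Qed.

Lemma pr_stable w P : (forall s y, s \in w -> y \in P -> s y \in P) ->
  forall y, y \in P -> (pr w) y \in P.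
Proof.
elim: w => [|s w IHw] h y yP; first by rewrite big_nil perm1.
rewrite big_cons permM; apply: IHw; last by apply: h; rewrite ?mem_head.
by move=> t z tw; apply: h; rewrite inE tw orbT.
Qed.

Lemma supp_perm s y : (s y \in supp s) = (y \in supp s).
Proof. by rewrite !inE (inj_eq perm_inj). Qed.

(** The cycle sends the last point of [P] to the first of [Q], so [P] is not stable under the
    product and some factor carries a point of [P] out of it. *)
Lemma cyc_connected P Q w : uniq (P ++ Q) -> P != [::] -> Q != [::] ->
  pr w = cyc (P ++ Q) -> on (P ++ Q) w ->
  exists s y z, [/\ s \in w, y \in P, z \in Q, y \in supp s & z \in supp s].
Proof.
case/lastP: P => // P p; case: Q => // q Q u _ _ e o.
have [/hasP[s sw /hasP[y yP syP]]|h] :=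
  boolP (has (fun s => has (fun y => s y \notin rcons P p) (rcons P p)) w).
  have sy : y \in supp s by rewrite inE; apply: contraNneq syP => ->.
  exists s, y, (s y); rewrite supp_perm; split=> //.
  have [_ /(_ (s y))] := o _ sw; rewrite supp_perm mem_cat (negPf syP).
  exact.
have := @pr_stable w (rcons P p) _ p; rewrite e cat_rcons cyc_step; last by rewrite -cat_rcons.
rewrite mem_rcons mem_head => H; have {}H : q \in rcons P p.
  apply: H => // s y sw yP; apply: contraNT h => n.
  by apply/hasP; exists s => //; apply/hasP; exists y.
by move: (uniq_count q u) H; rewrite mem_count count_cat /= eqxx; lia.
Qed.

Definition off A w := forall s, s \in w -> ~ {subset supp s <= A}.

Lemma on_off v A B w : on B w -> (forall z, z \in A -> z \in B -> z = v) -> off A w.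
Proof.
move=> o h s /o[s2 sB] sA.
have /subset_leq_card : supp s \subset [set v].
  by apply/subsetP => z zs; rewrite inE (h z) ?eqxx ?sA ?sB.
by rewrite cards1 leqNgt s2.
Qed.

Lemma off_mem A w z s : z \in supp s -> z \notin A -> ~ {subset supp s <= A}.
Proof. by move=> zs zA h; move: (h _ zs); rewrite (negPf zA). Qed.

Lemma off_cat A w w' : off A w -> off A w' -> off A (w ++ w').
Proof. by move=> h h' s; rewrite mem_cat => /orP[/h|/h']. Qed.

(** Restricts an equality between sets of factors to the factors living on one interval. *)
Lemma on_off_eq A u r u' r' : on A u -> on A u' -> off A r -> off A r' ->
  u ++ r =i u' ++ r' -> u =i u'.
Proof.
have h w q w' q' : on A w -> off A q' -> w ++ q =i w' ++ q' -> {subset w <= w'}.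
  move=> o f e s sw; have := e s; rewrite !mem_cat sw /= => /esym/orP[//|/f].
  by have [_ sA] := o _ sw.
move=> o o' f f' e s; apply/idP/idP; first exact: (h _ _ _ _ o f' e).
by apply: (h _ r' _ r o' f) => // t; rewrite e.
Qed.

Ltac absurd_count u h1 h2 :=
  move: h1 h2; rewrite !mem_count; move: u; count_lia.

(** Write [A' = A ++ C]. Every factor lives on [x :: A], or on [C ++ L'], or is the first root
    cycle. The second root cycle moves both [x] and a point of [L'], so it is the first one. If [C]
    were nonempty, some factor of [w'] would join [x :: A] to [C]; only the root cycle could, but it
    also moves a point of [L']. *)
Lemma node_cut a c x A L vs w As Bs a' c' A' L' vs' w' As' Bs' :
  isCons c -> nf a (x :: A) w -> nfc c L vs As Bs ->
  isCons c' -> nf a' (x :: A') w' -> nfc c' L' vs' As' Bs' ->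
  uniq (x :: A ++ L) -> A ++ L = A' ++ L' -> size A <= size A' ->
  w ++ As ++ cyc (x :: vs) :: Bs =i w' ++ As' ++ cyc (x :: vs') :: Bs' ->
  A = A' /\ vs = vs'.
Proof.
move=> c0 ha hc c0' ha' hc' u e sA W.
have [C [EA' EL]] := cat_cut sA e; subst A' L.
have uL : uniq (C ++ L') by uniq_by u.
have uL' : uniq L' by uniq_by u.
have ox : on (x :: A) w by apply: nf_on ha _; uniq_by u.
have [oA oB] := nfc_on hc uL.
have sub := nfc_sub hc; have sub' := nfc_sub hc'.
have uv : uniq (x :: vs).
  by apply: (uniq_subcount u) => z; have := sub z; count_lia.
have uv' : uniq (x :: vs').
  by apply: (uniq_subcount u) => z; have := sub' z; count_lia.
have inW s : s \in w' ++ As' ++ cyc (x :: vs') :: Bs' ->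
   [\/ {subset supp s <= x :: A}, {subset supp s <= C ++ L'} | s = cyc (x :: vs)].
  rewrite -W !mem_cat inE => /or4P[sw|sw|/eqP->|sw].
  - by constructor 1; case: (ox _ sw).
  - by constructor 2; case: (oA _ sw).
  - by constructor 3.
  - by constructor 2; case: (oB _ sw).
have [v' [vs1 Ev]] : exists v' vs1, vs' = v' :: vs1.
  move: c0'; rewrite (nfc_isCons hc'); case: (vs') => // v' vs1 _.
  by exists v', vs1.
have sv' z : z \in supp (cyc (x :: vs')) = (z \in x :: vs').
  by apply: supp_cyc; rewrite // Ev.
have xs : x \in supp (cyc (x :: vs')) by rewrite sv' mem_head.
have vs'' : v' \in supp (cyc (x :: vs')) by rewrite sv' Ev !inE eqxx orbT.
have v'L : v' \in L'.
  by move: (sub' v'); rewrite mem_count Ev /= eqxx; clear_all; lia.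
have ev : vs = vs'.
  apply/esym/(cyc_head_inj uv') => //.
  have [|h|h|//] := inW (cyc (x :: vs')); first by rewrite !mem_cat mem_head !orbT.
  - by absurd_count (uniq_count v' u) (h _ vs'') v'L.
  - by absurd_count (uniq_count x u) (h _ xs) (mem_head x [::]).
split=> //; case: C e uL sub inW ha' hc oA oB sA W u => [|y C]; first by rewrite cats0.
move=> e uL sub inW ha' hc oA oB _ W u; exfalso.
have oa' : on (x :: A ++ y :: C) w' by apply: nf_on ha' _; uniq_by u.
have [|//|//|||s [y' [z [sw yP zQ ys zs]]]] := @cyc_connected (x :: A) (y :: C) w'.
- by uniq_by u.
- by rewrite (nf_prod ha') //; uniq_by u.
- exact: oa'.
have [|h|h|Es] := inW s; first by rewrite mem_cat sw.
- by absurd_count (uniq_count z u) (h _ zs) zQ.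
- by absurd_count (uniq_count y' u) (h _ ys) yP.
have [_ h] := oa' _ sw; rewrite Es ev in h.
by absurd_count (uniq_count v' u) (h _ vs'') v'L.
Qed.

(** As in [node_cut]: if [A' = A ++ C] with [C] nonempty, some factor of [wa'] joins [v :: A] to
    [C], whereas each factor on the left lives on [v :: A], on [C ++ L'] or on [B ++ [:: v]]. *)
Lemma chain_cut b a c B v A L vs wb wa As Bs b' a' c' A' L' vs' wb' wa' As' Bs' :
  nf b (B ++ [:: v]) wb -> nf a (v :: A) wa -> nfc c L vs As Bs ->
  nf b' (B ++ [:: v]) wb' -> nf a' (v :: A') wa' -> nfc c' L' vs' As' Bs' ->
  uniq (B ++ v :: A ++ L) -> A ++ L = A' ++ L' -> size A <= size A' ->
  (wa ++ As) ++ (Bs ++ wb) =i (wa' ++ As') ++ (Bs' ++ wb') ->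
  A = A'.
Proof.
move=> hb ha hc hb' ha' hc' u e sA W.
have [C [EA' EL]] := cat_cut sA e; subst A' L.
have ob : on (B ++ [:: v]) wb by apply: nf_on hb _; uniq_by u.
have oa : on (v :: A) wa by apply: nf_on ha _; uniq_by u.
have [|oA oB] := nfc_on hc; first by uniq_by u.
case: C e W u sA ha' hc oA oB => [|y C]; first by rewrite cats0.
move=> e W u sA ha' hc oA oB; exfalso.
have oa' : on (v :: A ++ y :: C) wa' by apply: nf_on ha' _; uniq_by u.
have [|//|//|||s [y' [z [sw yP zQ ys zs]]]] := @cyc_connected (v :: A) (y :: C) wa'.
- by uniq_by u.
- by rewrite (nf_prod ha') //; uniq_by u.
- exact: oa'.
have := W s; rewrite !mem_cat sw /= -!orbA => /or4P[/oa|/oA|/oB|/ob] [_ h].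
- by absurd_count (uniq_count z u) (h _ zs) zQ.
- by absurd_count (uniq_count y' u) (h _ ys) yP.
- by absurd_count (uniq_count y' u) (h _ ys) yP.
- by absurd_count (uniq_count z u) (h _ zs) zQ.
Qed.

(* Equal sets of factors suffice: their order is recovered from the supports. *)
Lemma nf_inj_mut :
  (forall T L w, nf T L w -> uniq L -> forall T' w', nf T' L w' -> w =i w' -> T = T') /\
  (forall c L vs As Bs, nfc c L vs As Bs -> uniq L ->
    forall c' As' Bs', nfc c' L vs As' Bs' -> As ++ Bs =i As' ++ Bs' -> c = c').
Proof.
apply: nf_mutind => [x _ T' w' h'|a c x A L vs w As Bs c0 ha IHa hc IHc u T' w' h' W|
  _ c' As' Bs' h' _|b a c B v A L vs wb wa As Bs hb IHb ha IHa hc IHc u c' As' Bs' h' W].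
- by rewrite (nf_leafE h' erefl).
- have L0 : A ++ L != [::].
    have := nfc_sub hc; have := nfc_isCons hc; rewrite c0; case: (vs) => // v ? _ /(_ v).
    by rewrite /= eqxx; case: (A) (L) => [|//] [].
  have [a' [c' [A' [L' [vs' [wa' [As' [Bs' [ET EL Ew [c0' ha' hc']]]]]]]]]] := nf_nodeE h' L0.
  subst T' w'.
  have [EA Ev] : A = A' /\ vs = vs'.
    have [sA|sA] := leqP (size A) (size A').
      exact: (node_cut c0 ha hc c0' ha' hc').
    have [|s|-> ->] // := node_cut c0' ha' hc' c0 ha hc _ (esym EL) (ltnW sA).
      by rewrite -EL.
  subst A' vs'; have {EL} EL : L = L'.
    by move/eqP: EL; rewrite eqseq_cat // => /andP[_ /eqP].
  subst L'.
  have uv : uniq (x :: vs).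
    by apply: (uniq_subcount u) => z; have := nfc_sub hc z; count_lia.
  have ss : on (x :: vs) [:: cyc (x :: vs)].
    by apply: on_cyc => //; rewrite /= ltnS -(nfc_isCons hc).
  have ua : uniq (x :: A) by uniq_by u.
  have uL : uniq L by uniq_by u.
  have [v vv] : exists v, v \in vs.
    move: c0; rewrite (nfc_isCons hc); case: (vs) => // v ? _.
    by exists v; rewrite mem_head.
  have [oA oB] := nfc_on hc uL; have [oA' oB'] := nfc_on hc' uL.
  have oS : off (x :: A) [:: cyc (x :: vs)].
    apply: (on_off (v := x) ss) => z; rewrite !mem_count.
    have := uniq_count z u; have := nfc_sub hc z; do 4 (rewrite /= ?count_cat).
    by clear_all; case: eqVneq => //; lia.
  have oS' : off L [:: cyc (x :: vs)].
    move=> s; rewrite inE => /eqP->; apply: (@off_mem _ [::] x).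
      by rewrite supp_cyc ?mem_head // /= ltnS -(nfc_isCons hc).
    by apply/negP; rewrite mem_count; have := uniq_count x u; do 3 (rewrite /= ?count_cat ?eqxx); clear_all; lia.
  have disj w1 : on L w1 -> off (x :: A) w1.
    move=> o; apply: (on_off (v := x) o) => z; rewrite !mem_count.
    by have := uniq_count z u; count_lia.
  have disj' w1 : on (x :: A) w1 -> off L w1.
    move=> o; apply: (on_off (v := x) o) => z; rewrite !mem_count.
    by have := uniq_count z u; count_lia.
  (* Each subtree is recovered from the factors on its own interval; the root cycle and the factors
     of the other interval do not fit into it. *)
  congr Node.
    apply: (IHa ua _ _ ha').
    apply: (@on_off_eq (x :: A) _ (As ++ cyc (x :: vs) :: Bs) _ (As' ++ cyc (x :: vs) :: Bs')) => //.
    + exact: nf_on ha _.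
    + exact: nf_on ha' _.
    + by apply: off_cat; [apply: disj | apply: (@off_cat _ [:: _]) => //; apply: disj].
    + by apply: off_cat; [apply: disj | apply: (@off_cat _ [:: _]) => //; apply: disj].
  apply: (IHc uL _ _ _ hc').
  apply: (@on_off_eq L _ (w ++ [:: cyc (x :: vs)]) _ (wa' ++ [:: cyc (x :: vs)])).
  + by apply/on_cat.
  + by apply/on_cat.
  + by apply: off_cat => //; apply: disj'; apply: nf_on ha _.
  + by apply: off_cat => //; apply: disj'; apply: nf_on ha' _.
  move=> s; have := W s; rewrite !mem_cat !inE.
  by do 6? case: (s \in _); rewrite ?orbT ?orbF //=; case: (_ == _).
- by have := nfc_isCons h'; case: (c').
have [b' [a' [c1 [B' [A' [L' [wb' [wa' [As1 [Bs1 [Ec EL EA EB [hb' ha' hc']]]]]]]]]]]] := nfc_consE h'.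
subst c' As' Bs'.
(* Both chains have the same next cycle point [v], and a duplicate-free list can be cut at [v] in
   one way only. *)
have [EB ER] := uniq_split u EL; subst B'.
have EA : A = A'.
  have [sA|sA] := leqP (size A) (size A').
    exact: (chain_cut hb ha hc hb' ha' hc').
  apply/esym/(chain_cut hb' ha' hc' hb ha hc _ (esym ER) (ltnW sA)) => [|s].
    by rewrite -ER.
  by rewrite W.
subst A'; have {EL ER} EL : L = L'.
  by move/eqP: ER; rewrite eqseq_cat // => /andP[_ /eqP].
subst L'.
have uL : uniq L by uniq_by u.
have ua : uniq (v :: A) by uniq_by u.
have ub : uniq (B ++ [:: v]) by uniq_by u.
have [oA oB] := nfc_on hc uL; have [oA' oB'] := nfc_on hc' uL.
have oa := nf_on ha ua; have ob := nf_on hb ub.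
have oa' := nf_on ha' ua; have ob' := nf_on hb' ub.
have oL : on L (As ++ Bs) by apply/on_cat.
have oL' : on L (As1 ++ Bs1) by apply/on_cat.
have D (A1 A2 : seq X) w : (forall z, z \in A1 -> z \in A2 -> z = v) -> on A2 w -> off A1 w.
  by move=> h o; apply: on_off o h.
(* The three intervals meet pairwise at most in [v], so each factor belongs to exactly one of
   them. *)
have D1 z : z \in v :: A -> z \in L -> z = v.
  by rewrite !mem_count; have := uniq_count z u; count_lia.
have D2 z : z \in v :: A -> z \in B ++ [:: v] -> z = v.
  rewrite !mem_count; have := uniq_count z u; do 4 (rewrite /= ?count_cat).
  by clear_all; case: eqVneq => //; lia.
have D3 z : z \in B ++ [:: v] -> z \in L -> z = v.
  by rewrite !mem_count; have := uniq_count z u; count_lia.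
have D1' z (h1 : z \in L) (h2 : z \in v :: A) := D1 z h2 h1.
have D2' z (h1 : z \in B ++ [:: v]) (h2 : z \in v :: A) := D2 z h2 h1.
have D3' z (h1 : z \in L) (h2 : z \in B ++ [:: v]) := D3 z h2 h1.
congr Cons.
- apply: (IHb ub _ _ hb').
  apply: (@on_off_eq _ _ (wa ++ (As ++ Bs)) _ (wa' ++ (As1 ++ Bs1)) ob ob').
  + by apply: off_cat; [apply: D oa | apply: D oL].
  + by apply: off_cat; [apply: D oa' | apply: D oL'].
  move=> s; have := W s; rewrite !mem_cat.
  by do 8? case: (s \in _).
- apply: (IHa ua _ _ ha').
  apply: (@on_off_eq _ _ (wb ++ (As ++ Bs)) _ (wb' ++ (As1 ++ Bs1)) oa oa').
  + by apply: off_cat; [apply: D ob | apply: D oL].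
  + by apply: off_cat; [apply: D ob' | apply: D oL'].
  move=> s; have := W s; rewrite !mem_cat.
  by do 8? case: (s \in _).
apply: (IHc uL _ _ _ hc').
apply: (@on_off_eq _ _ (wa ++ wb) _ (wa' ++ wb') oL oL').
+ by apply: off_cat; [apply: D oa | apply: D ob].
+ by apply: off_cat; [apply: D oa' | apply: D ob'].
move=> s; have := W s; rewrite !mem_cat.
by do 8? case: (s \in _).
Qed.

Lemma nf_inj T T' L w w' : uniq L -> nf T L w -> nf T' L w' -> w =i w' -> T = T'.
Proof. by move=> u h h'; apply: (nf_inj_mut.1 _ _ _ h u _ _ h'). Qed.

End Inj.

(** * Every minimal factorization is equivalent to the word of a tree *)

Section Insert.
Local Open Scope group_scope.
Variable X : finType.
Implicit Types (x y z v : X) (A B L P Q vs : seq X) (w : seq {perm X}).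
Implicit Types (T a b : tree) (c : chain) (s : {perm X}).

Lemma supp_commute s t : (forall z, z \in supp s -> z \in supp t -> False) -> commute s t.
Proof.
move=> h; have fix' s' z : z \notin supp s' -> s' z = z by rewrite inE negbK => /eqP.
have half s' t' z : (forall z, z \in supp s' -> z \in supp t' -> False) ->
    z \in supp s' -> t' (s' z) = s' (t' z).
  move=> h' zs; have st y : y \in supp s' -> t' y = y.
    by move=> ys; apply: fix'; apply/negP; apply: h'.
  by rewrite !st ?supp_perm.
apply/permP=> z; rewrite !permM.
have [zs|zs] := boolP (z \in supp s); first exact: half.
have [zt|zt] := boolP (z \in supp t); last by rewrite !fix'.
by apply/esym/half => // y yt ys; apply: h ys yt.
Qed.

Lemma disjoint_ceq A B w w' :
  (forall s, s \in w -> {subset supp s <= A}) -> (forall s, s \in w' -> {subset supp s <= B}) ->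
  (forall z, z \in A -> z \in B -> False) -> ceq (w ++ w') (w' ++ w).
Proof.
move=> hw hw' d; apply: ceq_comm => s t sw tw; apply: supp_commute => z zs zt.
by apply: (d z); [apply: hw zs | apply: hw' zt].
Qed.

Lemma cat_split A L P Q z : A ++ L = P ++ z :: Q ->
  (exists2 R, A = P ++ z :: R & Q = R ++ L) \/ (exists2 R, P = A ++ R & L = R ++ z :: Q).
Proof.
move=> e; have [sA|sA] := leqP (size A) (size P).
  by have [R [-> ->]] := cat_cut sA e; right; exists R.
have [[|y R] [EA /= EQ]] := cat_cut (ltnW sA) (esym e).
  by rewrite EA cats0 ltnn in sA.
by case: EQ => -> ->; left; exists R.
Qed.

Lemma on_supp A w : on A w -> forall s, s \in w -> {subset supp s <= A}.
Proof. by move=> o s /o[]. Qed.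

(* [q] is the last factor together with the factors on the arcs that it cuts out
   of [M]; it meets the tree already built only at [z].  The second hypothesis is the
   case where [z] is the first point of the list. *)
Lemma nf_insert_mut (M : seq X) z (q : seq {perm X}) :
  on (M ++ [:: z]) q ->
  (forall Q T w, nf T (z :: Q) w -> uniq (M ++ z :: Q) ->
     exists T' w', nf T' (M ++ z :: Q) w' /\ ceq (w ++ q) w') ->
  (forall T L w, nf T L w -> forall P Q, L = P ++ z :: Q -> uniq (P ++ M ++ z :: Q) ->
     exists T' w', nf T' (P ++ M ++ z :: Q) w' /\ ceq (w ++ q) w') /\
  (forall c L vs As Bs, nfc c L vs As Bs -> forall P Q, L = P ++ z :: Q ->
     forall R, uniq (R ++ P ++ M ++ z :: Q) ->
     exists c' As' Bs', nfc c' (P ++ M ++ z :: Q) vs As' Bs' /\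
       ceq (As ++ cyc (R ++ vs) :: Bs ++ q) (As' ++ cyc (R ++ vs) :: Bs')).
Proof.
move=> oq H0; have sq := on_supp oq; apply: nf_mutind.
- move=> x [|? [|? ?]] //= [|? ?] // [Ex] u; subst x.
  exact: H0 (nfLeaf z) u.
- move=> a c x A L vs w As Bs c0 ha IHa hc IHc [|x' P] Q.
    case=> Ex EQ u; subst x Q; exact: H0 (nfNode c0 ha hc) u.
  case=> <- e u; have sub := nfc_sub hc.
  have [[A2 EA EQ]|[P2 EP EL]] := cat_split e.
    subst A Q; have [|T' [w' [h' eq']]] := IHa (x :: P) A2 erefl; first by uniq_by u.
    exists (Node T' c), (w' ++ As ++ cyc (x :: vs) :: Bs); split.
      have -> : (x :: P) ++ M ++ z :: A2 ++ L = x :: (P ++ M ++ z :: A2) ++ L.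
        by rewrite /= -!catA.
      exact: nfNode.
    have [oA oB] : on L As /\ on L Bs by apply: nfc_on hc _; uniq_by u.
    have sub2 s : s \in As ++ cyc (x :: vs) :: Bs -> {subset supp s <= x :: L}.
      have uv : uniq (x :: vs).
        by apply: (uniq_subcount u) => y'; have := sub y'; count_lia.
      rewrite mem_cat inE => /or3P[/oA[_ h]|/eqP->|/oB[_ h]] y yh.
      - by move/h: yh; rewrite !mem_count; count_lia.
      - by move/(supp_cycS uv): yh; have := sub y; rewrite !mem_count; count_lia.
      - by move/h: yh; rewrite !mem_count; count_lia.
    (* Here [z] lies in [A]: the remaining factors live on [x :: L], which misses [M ++ [:: z]], so
       [q] moves to the left past all of them and joins [w]. *)
    rewrite -catA; apply: ceq_trans (ceq_catr _ eq').
    rewrite -!catA; apply: ceq_catl.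
    have -> : As ++ (cyc (x :: vs) :: Bs) ++ q = (As ++ cyc (x :: vs) :: Bs) ++ q by rewrite -catA.
    apply: disjoint_ceq sub2 sq _ => y.
    by rewrite !mem_count; have := uniq_count y u; count_lia.
  subst P L; have [|c' [As' [Bs' [hc' eq']]]] := IHc P2 Q erefl [:: x]; first by uniq_by u.
  exists (Node a c'), (w ++ As' ++ cyc (x :: vs) :: Bs'); split.
    have -> : (x :: A ++ P2) ++ M ++ z :: Q = x :: A ++ (P2 ++ M ++ z :: Q) by rewrite /= -catA.
    by apply: nfNode => //; rewrite (nfc_isCons hc') -(nfc_isCons hc).
  by rewrite -!catA; apply: ceq_catl.
- by case.
move=> b a c B v A L vs wb wa As Bs hb IHb ha IHa hc IHc P Q e R u.
have sub := nfc_sub hc.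
have e1 : (B ++ [:: v]) ++ A ++ L = P ++ z :: Q by rewrite -catA.
(* The case [z = v] is assigned to the interval ending at [v]: its factors close the word, so [q] is
   already in place. *)
have [[B2 EB EQ]|[P1 EP EL]] := cat_split e1.
  subst Q; have [|T' [w' [h' eq']]] := IHb P B2 EB; first by uniq_by u.
  have [R' ER EB'] : exists2 R', z :: B2 = R' ++ [:: v] & B = P ++ R'.
    have [R' [r' ER]] : exists R' r', z :: B2 = R' ++ [:: r'].
      by case/lastP: (B2) => [|B3 y]; [exists [::], z | exists (z :: B3), y; rewrite cats1].
    by move: EB; rewrite ER catA !cats1 => /rcons_inj[-> ->]; exists R'; rewrite ?cats1.
  rewrite ER in h' *; exists (Cons T' a c), (wa ++ As), (Bs ++ w'); split.
    have -> : P ++ M ++ z :: B2 ++ A ++ L = (P ++ M ++ R') ++ v :: A ++ L.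
      by rewrite -!catA -cat_cons ER -catA.
    by apply: nfCons => //; rewrite -!catA.
  by rewrite -!catA; do 2 apply: ceq_catl; rewrite -cat_cons -[in X in ceq _ X]cat_cons; apply: ceq_catl.
have ob : on (B ++ [:: v]) wb by apply: nf_on hb _; subst P; uniq_by u.
have [[A2 EA EQ]|[P2 EP1 EL2]] := cat_split EL.
  subst P A Q; have [|T' [w' [h' eq']]] := IHa (v :: P1) A2 erefl; first by uniq_by u.
  exists (Cons b T' c), (w' ++ As), (Bs ++ wb); split.
    have -> : ((B ++ [:: v]) ++ P1) ++ M ++ z :: A2 ++ L = B ++ v :: (P1 ++ M ++ z :: A2) ++ L.
      by rewrite -!catA.
    exact: nfCons.
  have [oA oB] : on L As /\ on L Bs by apply: nfc_on hc _; uniq_by u.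
  have sub2 s : s \in As ++ cyc (R ++ v :: vs) :: Bs ++ wb ->
      {subset supp s <= R ++ B ++ v :: L}.
    have uv : uniq (R ++ v :: vs).
      by apply: (uniq_subcount u) => y'; have := sub y'; count_lia.
    rewrite mem_cat inE mem_cat => /or4P[/oA[_ h]|/eqP->|/oB[_ h]|/ob[_ h]] y yh.
    - by move/h: yh; rewrite !mem_count; count_lia.
    - by move/(supp_cycS uv): yh; have := sub y; rewrite !mem_count; count_lia.
    - by move/h: yh; rewrite !mem_count; count_lia.
    - by move/h: yh; rewrite !mem_count; count_lia.
  rewrite -catA -[in X in ceq _ X]catA; apply: ceq_trans (ceq_catr _ eq').
  rewrite -!catA; apply: ceq_catl.
  have -> : As ++ cyc (R ++ v :: vs) :: Bs ++ wb ++ q = (As ++ cyc (R ++ v :: vs) :: Bs ++ wb) ++ q.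
    by rewrite -!catA /= -!catA.
  apply: disjoint_ceq sub2 sq _ => y.
  by rewrite !mem_count; have := uniq_count y u; count_lia.
subst P P1 L; have [|c' [As' [Bs' [hc' eq']]]] := IHc P2 Q erefl (R ++ [:: v]); first by uniq_by u.
exists (Cons b a c'), (wa ++ As'), (Bs' ++ wb); split.
  have -> : ((B ++ [:: v]) ++ A ++ P2) ++ M ++ z :: Q = B ++ v :: A ++ (P2 ++ M ++ z :: Q).
    by rewrite -!catA.
  exact: nfCons.
rewrite -!catA; apply: ceq_catl.
rewrite -catA cat1s in eq'.
(* Here [z] lies in [L]: [q] has only to pass [wb], which lives on the disjoint list [B ++
   [:: v]]. *)
apply: (@ceq_trans _ (As ++ cyc (R ++ v :: vs) :: Bs ++ q ++ wb)).
  rewrite -(cat1s _ (Bs ++ _)) -(cat1s _ (Bs ++ q ++ _)); do 3 apply: ceq_catl.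
  by apply: disjoint_ceq (on_supp ob) sq _ => y; rewrite !mem_count; have := uniq_count y u; count_lia.
have -> : As ++ cyc (R ++ v :: vs) :: Bs ++ q ++ wb = (As ++ cyc (R ++ v :: vs) :: Bs ++ q) ++ wb.
  by rewrite -!catA /= -!catA.
have -> : As' ++ cyc (R ++ v :: vs) :: Bs' ++ wb = (As' ++ cyc (R ++ v :: vs) :: Bs') ++ wb.
  by rewrite -!catA.
exact: ceq_catr.
Qed.

End Insert.

(** * Component labels and removal of the last factor *)

Section Peel.
Local Open Scope group_scope.
Variable X : finType.
Implicit Types (x y z v : X) (A B L P Q vs : seq X) (w t : seq {perm X}).
Implicit Types (T a b : tree) (c : chain) (s : {perm X}) (rs : seq (X * seq X)).

Notation pr w := (\prod_(s <- w) s).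

Definition rank t := (\sum_(s <- t) #|supp s|.-1)%N.

Lemma rank_cat t w : rank (t ++ w) = (rank t + rank w)%N.
Proof. exact: big_cat. Qed.

(* [f] labels the connected components of the hypergraph whose edges are the
   supports of the factors. *)
Lemma labels t : exists2 f : X -> X,
  (forall s, s \in t -> forall x y, x \in supp s -> y \in supp s -> f x = f y) &
  #|X| <= #|f @: setT| + rank t.
Proof.
elim: t => [|s t [f hf card_f]].
  by exists id => //; rewrite imset_id cardsT leq_addr.
have [s0|[x0 x0s]] := set_0Vmem (supp s).
  exists f => [s'|]; last by rewrite /rank big_cons s0 cards0.
  by rewrite inE => /orP[/eqP-> x y|/hf//]; rewrite s0 inE.
(* All labels met by [s] are merged into that of [x0], which loses at most [#|supp s| - 1]
   labels. *)
pose g x := if f x \in f @: supp s then f x0 else f x.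
exists g => [s' |].
  rewrite inE => /orP[/eqP-> x y xs ys|s't x y xs ys].
    by rewrite /g !imset_f.
  by rewrite /g (hf _ s't x y).
have sub : f @: setT \subset (g @: setT) :|: ((f @: supp s) :\ f x0).
  apply/subsetP => _ /imsetP[x _ ->]; rewrite !inE.
  have [->|fx] := eqVneq (f x) (f x0).
    by rewrite (_ : f x0 = g x0) ?imset_f //= /g if_same.
  have [|fxs] := boolP (f x \in f @: supp s); first by rewrite orbT.
  by apply/orP; left; rewrite (_ : f x = g x) ?imset_f // /g (negPf fxs).
have := leq_trans (subset_leq_card sub) (leq_card_setU _ _).1.
have := cardsD1 (f x0) (f @: supp s); rewrite imset_f //=.
have := leq_imset_card f (supp s).
rewrite /rank big_cons -/(rank t); move: card_f.
have ar (n F r I D G S : nat) : n <= F + r -> I <= S -> I = (1 + D)%N -> F <= G + D ->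
    n <= G + (S.-1 + r) by lia.
exact: ar.
Qed.

Lemma label_pr (f : X -> X) t :
  (forall s, s \in t -> forall x y, x \in supp s -> y \in supp s -> f x = f y) ->
  forall x, f (pr t x) = f x.
Proof.
elim: t => [|s t IHt] h x; first by rewrite big_nil perm1.
rewrite big_cons permM IHt => [|s' s't]; last by apply: h; rewrite inE s't orbT.
have [xs|] := boolP (x \in supp s); last by rewrite inE negbK => /eqP->.
by apply: (h s); rewrite ?mem_head ?supp_perm.
Qed.

(* A list [(v_i, A_i)] describes the disjoint cycles [v_i :: A_i]. *)
Definition arc (r : X * seq X) : seq X := r.1 :: r.2.
Definition arcs rs : seq X := flatten (map arc rs).
Definition heads rs : seq X := map fst rs.
Definition tails_size rs : nat := (\sum_(r <- rs) size r.2)%N.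

Arguments arcs : simpl never.

Lemma arcs_cons r rs : arcs (r :: rs) = arc r ++ arcs rs.
Proof. by []. Qed.

Lemma arcs_cat rs rs' : arcs (rs ++ rs') = arcs rs ++ arcs rs'.
Proof. by rewrite /arcs map_cat flatten_cat. Qed.

Lemma heads_sub rs z : count_mem z (heads rs) <= count_mem z (arcs rs).
Proof. elim: rs => [|r rs IH] //; rewrite arcs_cons; move: IH. by count_lia. Qed.

Lemma arc_sub rs r : r \in rs -> {subset arc r <= arcs rs}.
Proof. by move=> rrs x xr; apply/flattenP; exists (arc r) => //; apply: map_f. Qed.

Lemma size_arcs rs : size (arcs rs) = (size rs + tails_size rs)%N.
Proof.
rewrite /tails_size; elim: rs => [|r rs IH]; first by rewrite big_nil.
by rewrite arcs_cons big_cons size_cat IH /=; lia.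
Qed.

(** There is at most one label per arc and one per point outside the arcs, that is at most
    [#|X| - tails_size rs] labels, and at least [#|X| - n] by assumption. In the case of equality
    distinct arcs carry distinct labels. *)
Lemma labels_arcs rs (f : X -> X) n : uniq (arcs rs) ->
  (forall r, r \in rs -> forall y, y \in arc r -> f y = f r.1) ->
  #|X| <= #|f @: setT| + n ->
  tails_size rs <= n /\
  (n <= tails_size rs -> {in heads rs &, injective f}).
Proof.
move=> u hf card_f.
have sub : f @: setT \subset (f @: ~: [set x in arcs rs]) :|: (f @: [set x in heads rs]).
  apply/subsetP => _ /imsetP[x _ ->]; rewrite inE.
  have [|xn] := boolP (x \in arcs rs); last by rewrite imset_f // !inE.
  case/flattenP => _ /mapP[r rrs ->] /(hf _ rrs)->.
  by rewrite orbC imset_f // inE map_f.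
have uh : uniq (heads rs) by apply: (uniq_subcount u) => z; apply: heads_sub.
have ch : #|[set x in heads rs]| = size rs by rewrite cardsE (card_uniqP uh) size_map.
have ca : #|[set x in arcs rs]| = (size rs + tails_size rs)%N.
  by rewrite cardsE (card_uniqP u) size_arcs.
have h1 := leq_trans (subset_leq_card sub) (leq_card_setU _ _).1.
have h2 := leq_imset_card f (~: [set x in arcs rs]).
have h3 := leq_imset_card f [set x in heads rs].
have h4 := cardsC [set x in arcs rs].
have ar1 (m I C H N Hd S Ta x : nat) : I <= C + H -> C <= N -> H <= Hd ->
    (Ta + N = x)%N -> x <= I + n -> Ta = (S + m)%N -> Hd = S -> m <= n by lia.
have ar2 (m I C H N Hd S Ta x : nat) : I <= C + H -> C <= N -> H <= Hd ->
    (Ta + N = x)%N -> x <= I + n -> Ta = (S + m)%N -> Hd = S -> n <= m -> H == Hd by lia.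
split; first exact: (ar1 _ _ _ _ _ _ _ _ _ h1 h2 h3 h4 card_f ca ch).
move=> n_le; have : #|f @: [set x in heads rs]| == #|[set x in heads rs]|.
  exact: (ar2 _ _ _ _ _ _ _ _ _ h1 h2 h3 h4 card_f ca ch n_le).
by move/imset_injP => inj x y xh yh; apply: inj; rewrite inE.
Qed.

Lemma const_along (S : Type) (f : X -> S) v A :
  (forall P x y Q, v :: A = P ++ x :: y :: Q -> f x = f y) ->
  forall y, y \in v :: A -> f y = f v.
Proof.
elim: A v => [|a A IHA] v h y; first by rewrite inE => /eqP->.
rewrite inE => /orP[/eqP->//|yA]; rewrite (h [::] v a A) //; apply: IHA yA => P x z Q E.
by apply: (h (v :: P) x z Q); rewrite E.
Qed.

Lemma pr_out t A x : on A t -> x \notin A -> pr t x = x.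
Proof.
elim: t => [|s t IHt] o xA; first by rewrite big_nil perm1.
have [os ot] := (on_cons A s t).1 o.
rewrite big_cons permM (_ : s x = x) ?IHt //.
have [_ h] := os s (mem_head _ _).
by apply/eqP; apply: contraNT xA => sx; apply: h; rewrite inE.
Qed.

Definition cycs rs : {perm X} := \prod_(r <- rs) cyc (arc r).

Lemma cycs_out rs x : uniq (arcs rs) -> x \notin arcs rs -> cycs rs x = x.
Proof.
rewrite /cycs; elim: rs => [|r rs IH]; first by rewrite big_nil perm1.
rewrite arcs_cons mem_cat negb_or big_cons permM => u /andP[xr xrs].
by rewrite cyc_out ?IH //; uniq_by u.
Qed.

Lemma cycs_in rs r x : uniq (arcs rs) -> r \in rs -> x \in arc r ->
  cycs rs x = cyc (arc r) x.
Proof.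
rewrite /cycs; elim: rs => // r' rs IH; rewrite arcs_cons big_cons permM => u.
have ur' : uniq (arc r') by uniq_by u.
have urs : uniq (arcs rs) by uniq_by u.
rewrite inE => /orP[/eqP->|rrs] xr.
  rewrite -/(cycs rs) cycs_out //; apply/negP; have : cyc (arc r') x \in arc r' by rewrite cyc_in.
  by move: (cyc _ x) => y; rewrite !mem_count; have := uniq_count y u; count_lia.
rewrite (@cyc_out _ (arc r')) ?IH //; have := arc_sub rrs xr; apply: contraL.
by rewrite -!has_pred1 !has_count; have := uniq_count x u; count_lia.
Qed.

(** Minimal factorizations of a product of disjoint cycles; by [tails_le_rank] this rank is the
    least possible. *)
Definition minarcs rs t := [/\ on (arcs rs) t, pr t = cycs rs & rank t = tails_size rs].

Lemma cycs_labels rs t (f : X -> X) : uniq (arcs rs) -> pr t = cycs rs ->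
  (forall x, f (pr t x) = f x) ->
  forall r, r \in rs -> forall y, y \in arc r -> f y = f r.1.
Proof.
move=> u e hf r rrs; apply: const_along => P x y Q E.
have ur : uniq (arc r).
  elim: rs rrs u {e} => // r' rs IH; rewrite arcs_cons inE => /orP[/eqP->|rrs] u; first by uniq_by u.
  by apply: IH => //; uniq_by u.
have xr : x \in arc r by rewrite [arc r]E mem_cat mem_head orbT.
by rewrite -(hf x) e (cycs_in u rrs xr) [arc r]E cyc_step // -E.
Qed.

Lemma tails_le_rank rs t : uniq (arcs rs) -> pr t = cycs rs -> tails_size rs <= rank t.
Proof.
move=> u e; have [f hf card_f] := labels t.
exact: (labels_arcs u (cycs_labels u e (label_pr hf)) card_f).1.
Qed.

Lemma ceq_filter (gT : finGroupType) (p : pred gT) (t : seq gT) :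
  (forall a b : gT, a \in t -> b \in t -> p a -> ~~ p b -> commute a b) ->
  ceq t (filter p t ++ filter (predC p) t).
Proof.
elim: t => [|a t IHt] h /=; first exact: ceq_refl.
have {IHt} IH : ceq t (filter p t ++ filter (predC p) t).
  by apply: IHt => b c bt ct; apply: h; rewrite inE ?bt ?ct orbT.
case: (boolP (p a)) => pa /=; first exact: (ceq_catl [:: a]).
apply: ceq_trans (ceq_catl [:: a] IH) _.
rewrite -(cat1s a (filter _ _)) !catA; apply: ceq_catr; apply: ceq_comm => b c.
rewrite inE mem_filter => /eqP-> /andP[pc ct].
by apply/esym/h; rewrite ?mem_head // inE ct orbT.
Qed.

Lemma ceq_prod t w : ceq t w -> pr t = pr w.
Proof.
elim=> {w} // P a b Q _ -> ab; rewrite !big_cat !big_cons /= !mulgA.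
by rewrite -(mulgA _ a b) ab !mulgA.
Qed.

Lemma ceq_rank t w : ceq t w -> rank t = rank w.
Proof. by move/ceq_perm=> h; apply: perm_big. Qed.

(** Minimality gives the heads distinct labels, so no factor meets both the first arc and another
    one. The factors on the first arc therefore commute with the rest, and the lower bound
    [tails_le_rank], applied to both groups, makes each of them minimal. *)
Lemma minarcs_split r rs t : uniq (arcs (r :: rs)) -> minarcs (r :: rs) t ->
  exists t1 t2, [/\ ceq t (t1 ++ t2), minarcs [:: r] t1 & minarcs rs t2].
Proof.
move=> u [ot et rt].
have [f hf card_f] := labels t.
have fpr := label_pr hf.
have farc := cycs_labels u et fpr.
have [_ inj] := labels_arcs u farc card_f.
have {}inj := inj (eq_leq rt).
have disj y : y \in arc r -> y \in arcs rs -> False.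
  by rewrite !mem_count; have := uniq_count y u; rewrite arcs_cons; count_lia.
pose p s := supp s \subset arc r.
have o2 s : s \in t -> ~~ p s -> {subset supp s <= arcs rs}.
  move=> st /subsetPn[y ys yr] x xs.
  have [_ sub] := ot _ st.
  have := sub _ xs; rewrite arcs_cons mem_cat => /orP[xr|//].
  have := sub _ ys; rewrite arcs_cons mem_cat (negPf yr) /= => /flattenP[_ /mapP[r' r'rs ->] yr'].
  have e1 := hf _ st _ _ xs ys.
  rewrite (farc r _ _ xr) ?mem_head // (farc r' _ _ yr') in e1; last by rewrite inE r'rs orbT.
  have e2 : r.1 = r'.1.
    by apply: inj e1; [rewrite inE eqxx | rewrite inE (map_f fst) ?orbT].
  case: (disj r.1); first by rewrite mem_head.
  by rewrite e2; apply: (arc_sub r'rs); rewrite mem_head.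
pose t1 := filter p t; pose t2 := filter (predC p) t.
have ceqt : ceq t (t1 ++ t2).
  apply: ceq_filter => a b at_ bt pa pb; apply: supp_commute => z za zb.
  by apply: (disj z); [apply: (subsetP pa) | apply: o2 zb].
have ot1 : on (arc r) t1.
  by move=> s; rewrite mem_filter => /andP[ps st]; split; [case: (ot _ st) | apply/subsetP].
have ot2 : on (arcs rs) t2.
  by move=> s; rewrite mem_filter => /andP[ps st]; split; [case: (ot _ st) | apply: o2].
have ept : pr t1 * pr t2 = cyc (arc r) * cycs rs.
  by rewrite -big_cat -(ceq_prod ceqt) et /cycs big_cons.
have ur : uniq (arc r) by uniq_by u.
have urs : uniq (arcs rs) by rewrite arcs_cons in u; uniq_by u.
have e1 : pr t1 = cyc (arc r).
  apply/permP => x; have [xr|xr] := boolP (x \in arc r); last first.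
    by rewrite (pr_out ot1) // cyc_out.
  have := congr1 (fun g : {perm X} => g x) ept; rewrite !permM.
  rewrite (pr_out ot2) => [->|]; last first.
    apply/negP; apply: disj; apply: pr_stable xr => s y st1 yr.
    have [ys|] := boolP (y \in supp s); last by rewrite inE negbK => /eqP->.
    by have [_ h] := ot1 _ st1; apply: h; rewrite supp_perm.
  rewrite cycs_out //; apply/negP; apply: disj; by rewrite cyc_in.
have e2 : pr t2 = cycs rs by move: ept; rewrite e1 => /mulgI.
have er : pr t1 = cycs [:: r] by rewrite e1 /cycs big_seq1.
have ur1 : uniq (arcs [:: r]) by rewrite /arcs /= cats0.
have l1 := tails_le_rank ur1 er; have l2 := tails_le_rank urs e2.
have rk : rank t = (rank t1 + rank t2)%N by rewrite (ceq_rank ceqt) rank_cat.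
have ts : tails_size (r :: rs) = (tails_size [:: r] + tails_size rs)%N.
  by rewrite /tails_size big_cons big_seq1.
exists t1, t2; split=> //; split=> //.
- by rewrite /arcs /= cats0.
- by move: l1 l2 rk rt; rewrite ts; lia.
- by move: l1 l2 rk rt; rewrite ts; lia.
Qed.

Lemma cycs_heads rs P : uniq (P ++ arcs rs) ->
  cycs rs * cyc (P ++ heads rs) = cyc (P ++ arcs rs).
Proof.
rewrite /cycs; elim: rs P => [|r rs IH] P u; first by rewrite big_nil mul1g.
rewrite big_cons -mulgA /= -(cat1s r.1) catA IH; last first.
  by rewrite arcs_cons in u; uniq_by u.
by rewrite -catA arcs_cons cyc_glueA.
Qed.

(** Meant for [S] the support of the last factor, whose points become the heads. *)
Lemma cut_arcs (S : pred X) L : exists P rs, [/\ L = P ++ arcs rs,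
  {in P, forall x, ~~ S x} &
  {in rs, forall r, S r.1 /\ {in r.2, forall x, ~~ S x}}].
Proof.
elim: L => [|x L [P [rs [-> hP hrs]]]]; first by exists [::], [::].
have [Sx|Sx] := boolP (S x).
  exists [::], ((x, P) :: rs); split=> // r; rewrite inE => /orP[/eqP->|/hrs] //.
exists (x :: P), rs; split=> // y; rewrite inE => /orP[/eqP->|/hP] //.
Qed.

(** Inside an arc [s] fixes the successor of a point, so [t] already maps the point to it and labels
    are constant on arcs. The rank bound makes the labels of the heads distinct. The last point of
    an arc is sent by [t] to a head with the same label, hence to its own head, and [s] must send
    that head to the next one. *)
Lemma last_factor_heads rs t s : uniq (arcs rs) ->
  pr t * s = cyc (arcs rs) -> rank t <= tails_size rs ->
  1 < size rs -> {subset supp s <= arcs rs} ->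
  {in rs, forall r, r.1 \in supp s /\ {in r.2, forall x, x \notin supp s}} ->
  s = cyc (heads rs).
Proof.
move=> u e rt s1 ss hrs.
have suppE x : (x \in supp s) = (x \in heads rs).
  apply/idP/idP => [xs|/mapP[r /hrs[? _] ->] //].
  have /flattenP[_ /mapP[r rrs ->]] := ss _ xs.
  have [_ h] := hrs _ rrs.
  by rewrite inE => /orP[/eqP->|/h]; [apply: map_f | rewrite xs].
have uh : uniq (heads rs) by apply: (uniq_subcount u) => z; apply: heads_sub.
have [f hf card_f] := labels t.
have fpr := label_pr hf.
have step x : s (pr t x) = cyc (arcs rs) x by rewrite -e permM.
have farc r : r \in rs -> forall y, y \in arc r -> f y = f r.1.
  move=> rrs; apply: const_along => P x y Q E.
  have [R1 [R2 ER]] : exists R1 R2, rs = R1 ++ r :: R2.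
    by case/splitPr: rrs => R1 R2; exists R1, R2.
  have EA : arcs rs = (arcs R1 ++ P) ++ x :: y :: (Q ++ arcs R2).
    by rewrite ER arcs_cat arcs_cons [arc r]E -!catA.
  have : s (pr t x) = y by rewrite step EA cyc_step // -EA.
  have ys : y \notin supp s.
    have [_ h] := hrs _ rrs; apply: h.
    by case: (P) E => [|p P'] [_ ->]; rewrite ?mem_head // mem_cat !inE eqxx !orbT.
  have sy : s y = y by move: ys; rewrite inE negbK => /eqP.
  by rewrite -{1}sy => /perm_inj <-; rewrite fpr.
have [_ inj] := labels_arcs u farc card_f.
have {}inj := inj rt.
apply/permP => x; have [xh|xh] := boolP (x \in heads rs); last first.
  by rewrite cyc_out //; move: xh; rewrite -suppE inE negbK => /eqP.
case/mapP: xh => r rrs ->{x}.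
have [R1 [R2 ER]] : exists R1 R2, rs = R1 ++ r :: R2.
  by case/splitPr: rrs => R1 R2; exists R1, R2.
(* Rotate so that [r] leads; the arc that follows it cyclically is then the second one, which exists
   since [1 < size rs]. *)
have eA : cyc (arcs rs) = cyc (arcs (r :: R2 ++ R1)).
  by rewrite -cat_cons arcs_cat cyc_rot -arcs_cat -ER.
have eH : cyc (heads rs) = cyc (heads (r :: R2 ++ R1)).
  by rewrite -cat_cons /heads map_cat cyc_rot -map_cat -ER.
have uA : uniq (arcs (r :: R2 ++ R1)).
  by rewrite -cat_cons arcs_cat uniq_catC -arcs_cat -ER.
have uH : uniq (heads (r :: R2 ++ R1)).
  by rewrite -cat_cons /heads map_cat uniq_catC -map_cat -ER.
have hR r' : r' \in R2 ++ R1 -> r' \in rs.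
  by rewrite ER !mem_cat inE => /orP[->|->]; rewrite ?orbT.
have sR : size rs = (size (R2 ++ R1)).+1 by rewrite ER !size_cat /=; lia.
case: (R2 ++ R1) eA eH uA uH hR sR => [|r' R] eA eH uA uH hR sR.
  by move: s1; rewrite sR.
have r'rs : r' \in rs by apply: hR; rewrite mem_head.
have EA : arcs (r :: r' :: R) = belast r.1 r.2 ++ last r.1 r.2 :: r'.1 :: (r'.2 ++ arcs R).
  by rewrite !arcs_cons [arc r]lastI cat_rcons.
have s1' : s (pr t (last r.1 r.2)) = r'.1 by rewrite step eA EA cyc_step // -EA.
have -> : cyc (heads rs) r.1 = r'.1 by rewrite eH (@cyc_step _ [::]).
rewrite -s1'; congr (s _).
have ph : pr t (last r.1 r.2) \in heads rs.
  by rewrite -suppE -supp_perm s1' suppE map_f.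
have ly : last r.1 r.2 \in arc r by rewrite /arc lastI mem_rcons mem_head.
by apply: inj; rewrite ?map_f // fpr (farc _ rrs _ ly).
Qed.

Lemma size_last_factor rs s : uniq (arcs rs) -> {subset supp s <= arcs rs} ->
  {in rs, forall r, r.1 \in supp s /\ {in r.2, forall x, x \notin supp s}} ->
  #|supp s| = size rs.
Proof.
move=> u ss hrs; have uh : uniq (heads rs).
  by apply: (uniq_subcount u) => z; apply: heads_sub.
rewrite -(size_map fst) -(card_uniqP uh); apply: eq_card => x.
apply/idP/idP => [xs|/mapP[r /hrs[? _] ->] //].
have /flattenP[_ /mapP[r rrs ->]] := ss _ xs.
have [_ h] := hrs _ rrs.
by rewrite inE => /orP[/eqP->|/h]; [apply: map_f | rewrite xs].
Qed.

Lemma minarcs1 v A t : minarcs [:: (v, A)] t <->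
  [/\ on (v :: A) t, pr t = cyc (v :: A) & rank t = size A].
Proof. by rewrite /minarcs /arcs /cycs /tails_size !big_seq1 /= cats0. Qed.

Definition reach t L := exists T w, nf T L w /\ ceq t w.

(** The new cycle point [z] comes right after [L], so the interval ending at it is trivial, hence a
    [Leaf]. *)
Lemma nfc_rcons c L vs As Bs T z Q w : nfc c L vs As Bs -> nf T (z :: Q) w ->
  exists c', nfc c' (L ++ z :: Q) (vs ++ [:: z]) (As ++ w) Bs.
Proof.
move=> hc h; elim: hc => {c L vs As Bs} [|b a c B v A L vs wb wa As Bs hb ha _ [c' hc']].
  exists (Cons Leaf T Nil); have := @nfCons _ Leaf T Nil [::] z Q [::] [::] [::] w [::] [::].
  by rewrite !cats0; apply=> //; [apply: nfLeaf | apply: nfNil].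
by exists (Cons b a c'); rewrite -!catA /= -!catA; apply: nfCons.
Qed.

(** Arcs start at their heads, so the intervals ending there are trivial and nothing follows the
    root cycle. The hypothesis on [reach] is the induction hypothesis of [minimal_nf]. *)
Lemma minarcs_chain rs t n :
  (forall L t, size t <= n -> L != [::] -> uniq L -> on L t -> pr t = cyc L ->
     rank t = (size L).-1 -> reach t L) ->
  size t <= n -> uniq (arcs rs) -> minarcs rs t ->
  exists c As, nfc c (arcs rs) (heads rs) As [::] /\ ceq t As.
Proof.
move=> H; elim: rs t => [|[v A] rs IH] t st u.
  case=> ot _ _; exists Nil, [::]; split; first exact: nfNil.
  case: t ot {st} => [_|s t o]; first exact: ceq_refl.
  have [/ltnW s0 h] := o s (mem_head _ _).
  by have /card_gt0P[x /h] := s0.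
move=> m; have [t1 [t2 [e /minarcs1[o1 p1 r1] m2]]] := minarcs_split u m.
have st12 : size t1 + size t2 <= n by rewrite -size_cat -(perm_size (ceq_perm e)).
have [||c [As [hc ec]]] := IH t2 _ _ m2.
- by apply: leq_trans st12; rewrite leq_addl.
- by rewrite arcs_cons in u; uniq_by u.
have [||||//|//|T [w [hw ew]]] := H (v :: A) t1 => //.
- by apply: leq_trans st12; rewrite leq_addr.
- by rewrite arcs_cons in u; uniq_by u.
exists (Cons Leaf T c), (w ++ As); split; last exact: ceq_trans e (ceq_cat ew ec).
by apply: (@nfCons _ Leaf T c [::] v A _ _ [::] _ _ [::]) => //; apply: nfLeaf.
Qed.

Lemma minimal_nf n L t : size t <= n -> L != [::] -> uniq L -> on L t ->
  pr t = cyc L -> rank t = (size L).-1 -> reach t L.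
Proof.
elim: n L t => [|n IH] L t.
  case: t => // _; case: L => // x [|y L] _ _ _ _; rewrite /rank big_nil => // _.
  by exists Leaf, [::]; split; [apply: nfLeaf | apply: ceq_refl].
case/lastP: t => [|t s] st L0 u o.
  by move=> e r; apply: IH.
rewrite -cats1 in o st *; rewrite big_cat big_seq1 rank_cat => e rt.
have [ot os] := (on_cat L t [:: s]).1 o.
have [s2 ss] := os s (mem_head _ _).
have {}rt : rank t = (size L - #|supp s|)%N.
  by move: rt; rewrite /rank big_seq1 -/(rank t); move: (#|supp s|) s2 => k; lia.
have [P [rs0 [EL hP hrs0]]] := cut_arcs (fun x => x \in supp s) L.
case/lastP: rs0 EL hrs0 => [|rs1 [z Q]] EL hrs0.
  have /ltnW/card_gt0P[x xs] := s2; have := hP x; rewrite xs.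
  by have := ss _ xs; rewrite EL /arcs cats0 => xP /(_ xP).
rewrite -cats1 in EL hrs0; rewrite arcs_cat /arcs /= cats0 -/(arcs rs1) in EL.
(* [z] is the last point of [s] along the list; its arc wraps around the end and absorbs [P], and is
   put in front. *)
pose rs := (z, Q ++ P) :: rs1.
have Ers : arcs rs = (z :: Q) ++ P ++ arcs rs1 by rewrite arcs_cons /arc /= catA.
have uL : uniq ((P ++ arcs rs1) ++ (z :: Q)) by rewrite -catA -EL.
have urs : uniq (arcs rs) by rewrite Ers uniq_catC.
have eL : cyc L = cyc (arcs rs) by rewrite Ers cyc_rot // EL -catA.
have mem_rs x : (x \in arcs rs) = (x \in L) by rewrite Ers EL !mem_cat orbC orbA.
have szL : size L = size (arcs rs) by rewrite Ers EL !size_cat /=; lia.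
have ssrs : {subset supp s <= arcs rs} by move=> x; rewrite mem_rs; apply: ss.
have hrs : {in rs, forall r, r.1 \in supp s /\ {in r.2, forall x, x \notin supp s}}.
  move=> r; rewrite inE => /orP[/eqP->|rrs]; last by apply: hrs0; rewrite mem_cat rrs.
  have [|h1 h2] := hrs0 (z, Q); first by rewrite mem_cat mem_head orbT.
  by split=> // x; rewrite mem_cat => /orP[/h2|/hP].
have cs := size_last_factor urs ssrs hrs.
have rt' : rank t = tails_size rs by rewrite rt szL size_arcs cs addKn.
have es : s = cyc (heads rs).
  apply: (last_factor_heads urs _ (eq_leq rt')) => //; last by rewrite -cs.
  by rewrite e.
have mt : minarcs rs t.
  split=> //; first by apply: on_sub ot => x; rewrite mem_rs.
  have := @cycs_heads rs [::] urs; rewrite /= -es -eL -e => /mulIg->//.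
have [t0 [t1 [et /minarcs1[o0 p0 r0] m1]]] := minarcs_split urs mt.
have st' : size t0 + size t1 <= n.
  by rewrite -size_cat -(perm_size (ceq_perm et)); move: st; rewrite size_cat addn1.
have u0 : uniq (P ++ z :: Q) by uniq_by uL.
have [||||||T0 [w0 [h0 e0]]] := IH (P ++ z :: Q) t0.
- by apply: leq_trans st'; rewrite leq_addr.
- by case: (P).
- exact: u0.
- by apply: on_sub o0 => x; rewrite !inE !mem_cat inE => /or3P[]->; rewrite ?orbT.
- by rewrite p0 -cyc_rot.
- by rewrite r0 !size_cat /=; lia.
(* As [s] moves two points there is another arc; its head [v] opens the block to be inserted before
   [z]. *)
have [v [A [rs2 E1]]] : exists v A rs2, rs1 = (v, A) :: rs2.
  by move: cs s2; rewrite /rs; case: (rs1) => [->|[v A] rs2] // *; exists v, A, rs2.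
have EM : arcs rs1 = v :: A ++ arcs rs2 by rewrite E1.
rewrite E1 in m1; rewrite EM in EL uL.
have u1 : uniq (v :: A ++ arcs rs2) by uniq_by uL.
have u2 : uniq (arcs rs2) by uniq_by uL.
have uv : uniq (v :: A) by uniq_by uL.
have [t2 [t3 [e2 /minarcs1[o2 p2 r2] m3]]] := @minarcs_split (v, A) rs2 t1 u1 m1.
have st2 : size t2 + size t3 <= n.
  by rewrite -size_cat -(perm_size (ceq_perm e2)); apply: leq_trans st'; rewrite leq_addl.
have [||||||Tv [wv [hv ev]]] := IH (v :: A) t2 => //.
  by apply: leq_trans st2; rewrite leq_addr.
have [|c [As [hc ec]]] := minarcs_chain IH _ u2 m3.
  by apply: leq_trans st2; rewrite leq_addl.
(* The inserted piece: the word of the arc at [v], those of the arcs after it, then [s]. *)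
pose q := wv ++ As ++ [:: s].
have uhs : uniq (heads rs1 ++ [:: z]).
  have := heads_sub rs2 => sub; apply: (uniq_subcount uL) => x; have := sub x.
  by rewrite E1; count_lia.
have es' : s = cyc (heads rs1 ++ [:: z]) by rewrite -cyc_rot.
have ov : on (v :: A) wv := nf_on hv uv.
have [oAs _] := nfc_on hc u2.
have oq : on ((v :: A ++ arcs rs2) ++ [:: z]) q.
  apply/on_cat; split; last (apply/on_cat; split).
  - by apply: on_sub ov; apply: count_subset => x; count_lia.
  - by apply: on_sub oAs; apply: count_subset => x; count_lia.
  rewrite es' E1; apply: on_cyc; rewrite -?E1 //; first by rewrite E1 /= size_cat addn1.
  by apply: count_subset => x; have := heads_sub rs2 x; rewrite E1; count_lia.
(* When the tree starts at [z], [s] becomes a new root with first point [v], and the old tree hangs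
   from its last point [z]. *)
have H0 Q' T w : nf T (z :: Q') w -> uniq ((v :: A ++ arcs rs2) ++ z :: Q') ->
    exists T' w', nf T' ((v :: A ++ arcs rs2) ++ z :: Q') w' /\ ceq (w ++ q) w'.
  move=> hw uw; have [c' hc'] := nfc_rcons hc hw.
  exists (Node Tv c'), (wv ++ (As ++ w) ++ [:: cyc (v :: heads rs2 ++ [:: z])]); split.
    rewrite /= -catA; apply: nfNode => //.
    by rewrite (nfc_isCons hc') size_cat addn1.
  have ow : on (z :: Q') w by apply: nf_on hw _; uniq_by uw.
  have -> : cyc (v :: heads rs2 ++ [:: z]) = s by rewrite es' E1.
  have -> : w ++ q = (w ++ (wv ++ As)) ++ [:: s] by rewrite /q !catA.
  have -> : wv ++ (As ++ w) ++ [:: s] = ((wv ++ As) ++ w) ++ [:: s] by rewrite !catA.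
  apply: ceq_catr; have owA : on (v :: A ++ arcs rs2) (wv ++ As).
    apply/on_cat; split.
    - by apply: on_sub ov; apply: count_subset => x; count_lia.
    - by apply: on_sub oAs; apply: count_subset => x; count_lia.
  apply: disjoint_ceq (on_supp ow) (on_supp owA) _ => x.
  by rewrite !mem_count; have := uniq_count x uw; count_lia.
have [|T [w [hw ew]]] := (nf_insert_mut oq H0).1 _ _ _ h0 P Q erefl.
  by rewrite catA.
exists T, w; split; first by rewrite EL.
apply: ceq_trans ew; rewrite /q [wv ++ _]catA catA; apply: ceq_catr.
apply: ceq_trans et _; apply: ceq_cat => //.
by apply: ceq_trans e2 _; apply: ceq_cat.
Qed.

End Peel.

(** * Counting trees *)

Fixpoint tree_eqb T T' {struct T} :=
  match T, T' with
  | Leaf, Leaf => true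
  | Node a c, Node a' c' => tree_eqb a a' && chain_eqb c c'
  | _, _ => false
  end
with chain_eqb c c' {struct c} :=
  match c, c' with
  | Nil, Nil => true
  | Cons b a c, Cons b' a' c' => [&& tree_eqb b b', tree_eqb a a' & chain_eqb c c']
  | _, _ => false
  end.

Lemma tree_eqbP : Equality.axiom tree_eqb.
Proof.
have [H _] : (forall T T', tree_eqb T T' <-> T = T') /\
  (forall c c', chain_eqb c c' <-> c = c').
  apply: tree_mutind => [[|a c]|a IHa c IHc [|a' c']|[|b a c]|b IHb a IHa c IHc [|b' a' c']] //=.
    by split=> [/andP[/IHa-> /IHc->]|[<- <-]] //; apply/andP; split; [apply/IHa | apply/IHc].
  split=> [/and3P[/IHb-> /IHa-> /IHc->]|[<- <- <-]] //.
  by apply/and3P; split; [apply/IHb | apply/IHa | apply/IHc].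
by move=> T T'; apply: (iffP idP) => /H.
Qed.

HB.instance Definition _ := hasDecEq.Build tree tree_eqbP.

(** A chain becomes a list of even length [2 (j - 1)]; together with the first subtree this is the
    forest of [2 j - 1] trees under a [j]-cycle. *)
Fixpoint chain_kids c : seq tree :=
  if c is Cons b a c then b :: a :: chain_kids c else [::].

Fixpoint chain_of (f : seq tree) : chain :=
  if f is b :: a :: f then Cons b a (chain_of f) else Nil.

Lemma chain_kidsK : cancel chain_kids chain_of.
Proof. by elim=> //= b a c ->. Qed.

Lemma chain_ofK f : ~~ odd (size f) -> chain_kids (chain_of f) = f.
Proof.
have [n] := ubnP (size f); elim: n f => // n IH [|b [|a f]] //= sf.
by rewrite negbK => of_; rewrite IH //; lia.
Qed.

Lemma size_chain_kids c : size (chain_kids c) = (chain_len c).*2.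
Proof. by elim: c => //= b a c ->; rewrite doubleS. Qed.

Definition forest_wf (f : seq tree) := all tree_wf f.
Definition forest_cnt j (f : seq tree) := (\sum_(T <- f) tree_cnt j T)%N.
Definition forest_size (f : seq tree) := (\sum_(T <- f) tree_size T)%N.

Lemma chain_wf_kids c : chain_wf c = forest_wf (chain_kids c).
Proof. by elim: c => //= b a c ->. Qed.

Lemma chain_cnt_kids j c : chain_cnt j c = forest_cnt j (chain_kids c).
Proof.
rewrite /forest_cnt; elim: c => [|b a c IH] /=; first by rewrite big_nil.
by rewrite !big_cons IH addnA.
Qed.

Lemma chain_size_kids c : chain_size c = (chain_len c + forest_size (chain_kids c))%N.
Proof.
rewrite /forest_size; elim: c => [|b a c IH] /=; first by rewrite big_nil.
by rewrite !big_cons IH; lia.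
Qed.

(* Removing the root of the first tree of a forest replaces it by its
   [2 i + 3] subtrees; [graft i] is the inverse operation. *)
Definition graft i (f : seq tree) : seq tree :=
  if f is a :: f' then Node a (chain_of (take i.*2.+2 f')) :: drop i.*2.+2 f' else [::].

Definition ungraft (f : seq tree) : seq tree :=
  if f is Node a c :: f' then a :: chain_kids c ++ f' else [::].

Lemma graftK i f : i.*2.+2 < size f -> ungraft (graft i f) = f.
Proof.
case: f => //= a f; rewrite ltnS => sf; rewrite chain_ofK ?cat_take_drop //.
by rewrite size_takel //= odd_double.
Qed.

Lemma graft_inv i f : i.*2.+2 < size f -> exists a c f',
  [/\ graft i f = Node a c :: f', f = a :: chain_kids c ++ f' & chain_len c = i.+1].
Proof.
case: f => //= a f sf; exists a, (chain_of (take i.*2.+2 f)), (drop i.*2.+2 f).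
have e : chain_kids (chain_of (take i.*2.+2 f)) = take i.*2.+2 f.
  by rewrite chain_ofK // size_takel //= odd_double.
split=> //; first by rewrite e cat_take_drop.
by apply: double_inj; rewrite -size_chain_kids e size_takel.
Qed.

Lemma ungraftK a c f : isCons c ->
  graft (chain_len c).-1 (a :: chain_kids c ++ f) = Node a c :: f.
Proof.
move=> c0; have e : (chain_len c).-1.*2.+2 = size (chain_kids c).
  by rewrite size_chain_kids; case: c c0.
by rewrite /= e take_size_cat // drop_size_cat // chain_kidsK.
Qed.

(** * Enumeration of the forests of given type *)

Section Forests.
Variable N : nat.
Implicit Types (m : 'X_{1..N}) (f : seq tree).

(** If the first tree is a leaf, [k] drops. Otherwise its root is removed: the degree drops while
    the number of trees grows. Hence a lexicographic recursion, with [prev] the enumeration for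
    smaller degree. *)
Definition forests_step (prev : nat -> 'X_{1..N} -> seq (seq tree)) :=
  fix forests k m := if k is k'.+1 then
      map (cons Leaf) (forests k' m) ++
      [seq graft i f | i : 'I_N <- [seq i <- enum 'I_N | (m i != 0)%N],
                       f : seq tree <- prev (i.*2 + 3 + k')%N (m - U_(i))%MM]
    else if m == 0%MM then [:: [::]] else [::].

Fixpoint forests d : nat -> 'X_{1..N} -> seq (seq tree) :=
  forests_step (if d is d'.+1 then forests d' else fun _ _ => [::]).

Definition nforests k m := size (forests (mdeg m) k m).

Lemma mdeg_sub1 m i : (m i != 0)%N -> (mdeg (m - U_(i))).+1 = mdeg m.
Proof.
move=> mi; have /submK {2}<- : (U_(i) <= m)%MM by rewrite lep1mP.
by rewrite mdegD mdeg1 addn1.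
Qed.

Lemma nforests0 m : nforests 0 m = (m == 0%MM).
Proof. by rewrite /nforests; case: (mdeg m) => [|d] /=; case: (m == 0%MM). Qed.

Lemma nforestsS k m : nforests k.+1 m =
  (nforests k m + \sum_(i < N | (m i != 0)%N) nforests (i.*2 + 3 + k) (m - U_(i))%MM)%N.
Proof.
rewrite /nforests.
have -> : forests (mdeg m) k.+1 m = map (cons Leaf) (forests (mdeg m) k m) ++
      [seq graft i f | i : 'I_N <- [seq i <- enum 'I_N | (m i != 0)%N],
        f : seq tree <- (if mdeg m is d'.+1 then forests d' else fun _ _ => [::]) (i.*2 + 3 + k)%N (m - U_(i))%MM].
  by case: (mdeg m).
rewrite size_cat size_map size_allpairs_dep; congr addn.
rewrite sumnE big_map big_filter big_enum_cond /=; apply: eq_bigr => i mi.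
by rewrite -(mdeg_sub1 mi).
Qed.

Lemma weight_sub1 m i : (m i != 0)%N -> weight m = (weight (m - U_(i))%MM + i.+1)%N.
Proof.
move=> mi; rewrite /weight (bigD1 i) //= [in RHS](bigD1 i) //=.
rewrite mnmBE mnm1E eqxx (eq_bigr (fun j : 'I_N => j.+1 * (m - U_(i))%MM j)%N); first by nia.
by move=> j ji; rewrite mnmBE mnm1E eq_sym (negPf ji) subn0.
Qed.

Lemma alpha_of_ord m (i : 'I_N) : alpha_of m i.+2 = m i.
Proof. by rewrite /alpha_of /= subSS subSS subn0 valK. Qed.

Lemma alpha_of_out m j : alpha_of m j != 0%N -> exists2 i : 'I_N, j = i.+2 & (m i != 0)%N.
Proof.
rewrite /alpha_of; case: ltnP => // j2; case: insubP => // i _ e mi.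
have ei : nat_of_ord i = (j - 2)%N := e.
by exists i => //; lia.
Qed.

Lemma alpha_of_sub1 m (i : 'I_N) j : (m i != 0)%N ->
  alpha_of m j = (alpha_of (m - U_(i))%MM j + (j == i.+2))%N.
Proof.
move=> mi; rewrite /alpha_of; case: ltnP => j2; first by case: eqP => //; lia.
case: insubP => [k _ e|].
  have ek : nat_of_ord k = (j - 2)%N := e.
  rewrite mnmBE mnm1E; have [eik|ik] := eqVneq i k.
    rewrite -eik in ek *.
    by rewrite (_ : j == i.+2) ?subnK ?lt0n //; apply/eqP; lia.
  have -> : (j == i.+2) = false by apply: contraNF ik => /eqP ej; apply/eqP/val_inj => /=; lia.
  by rewrite subn0 addn0.
by case: eqP => [-> |//]; rewrite subSS subSS subn0 ltn_ord.
Qed.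

Lemma alpha_of0 j : alpha_of (0%MM : 'X_{1..N}) j = 0%N.
Proof. by rewrite /alpha_of; case: ltnP => // _; case: insubP => // i; rewrite mnm0E. Qed.

Lemma forest_cnt_cons j T f : forest_cnt j (T :: f) = (tree_cnt j T + forest_cnt j f)%N.
Proof. exact: big_cons. Qed.

Lemma forest_cnt_cat j f g : forest_cnt j (f ++ g) = (forest_cnt j f + forest_cnt j g)%N.
Proof. exact: big_cat. Qed.

Lemma forest_size_cons T f : forest_size (T :: f) = (tree_size T + forest_size f)%N.
Proof. exact: big_cons. Qed.

Lemma forest_size_cat f g : forest_size (f ++ g) = (forest_size f + forest_size g)%N.
Proof. exact: big_cat. Qed.

Lemma mem_forestsS d k m f : mdeg m <= d ->
  f \in forests d k.+1 m ->
  (exists2 f', f' \in forests d k m & f = Leaf :: f') \/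
  (exists d' (i : 'I_N) f', [/\ d = d'.+1, (m i != 0)%N, f = graft i f' &
     f' \in forests d' (i.*2 + 3 + k) (m - U_(i))%MM]).
Proof.
move=> md; have -> : forests d k.+1 m = map (cons Leaf) (forests d k m) ++
      [seq graft i f | i : 'I_N <- [seq i <- enum 'I_N | (m i != 0)%N],
        f : seq tree <- (if d is d'.+1 then forests d' else fun _ _ => [::]) (i.*2 + 3 + k)%N (m - U_(i))%MM].
  by case: (d).
rewrite mem_cat => /orP[/mapP[f' f'in ->]|]; first by left; exists f'.
case/allpairsPdep=> i [f' []]; rewrite mem_filter => /andP[mi _].
case: d md => [|d] // md f'in ->; right; exists d, i, f'; split=> //.
Qed.

Lemma forests_sound d k m f : mdeg m <= d -> f \in forests d k m ->
  [/\ size f = k, forest_wf f, forall j, forest_cnt j f = alpha_of m j &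
      forest_size f = weight m].
Proof.
elim: d k m f => [|d IHd] k m f; elim: k m f => [|k IHk] m f md.
- rewrite /=; case: eqP => // ->; rewrite inE => /eqP->; split=> // [j|].
    by rewrite alpha_of0 /forest_cnt big_nil.
  by rewrite /forest_size big_nil /weight big1 // => i _; rewrite mnm0E muln0.
- case/(mem_forestsS md) => [[f' /(IHk _ _ md)[sf wf cf zf] ->]|[d' [i [f' []]]] //].
  split=> //=; first by rewrite sf.
    by move=> j; rewrite forest_cnt_cons cf.
  by rewrite forest_size_cons zf.
- rewrite /=; case: eqP => // ->; rewrite inE => /eqP->; split=> // [j|].
    by rewrite alpha_of0 /forest_cnt big_nil.
  by rewrite /forest_size big_nil /weight big1 // => i _; rewrite mnm0E muln0.
case/(mem_forestsS md) => [[f' /(IHk _ _ md)[sf wf cf zf] ->]|[d' [i [f' [[<-] mi -> f'in]]]]].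
  split=> //=; first by rewrite sf.
    by move=> j; rewrite forest_cnt_cons cf.
  by rewrite forest_size_cons zf.
have md' : mdeg (m - U_(i))%MM <= d by rewrite -ltnS (mdeg_sub1 mi).
have [sf wf cf zf] := IHd _ _ _ md' f'in.
have [|a [c [g [-> Ef' lc]]]] := @graft_inv i f'; first by rewrite sf; lia.
have c0 : isCons c by case: (c) lc.
move: wf; rewrite Ef' /= /forest_wf all_cat => /and3P[wa wc wg].
split.
- by move: sf; rewrite Ef' /= size_cat size_chain_kids lc /=; lia.
- by rewrite /= c0 wa chain_wf_kids /forest_wf wc wg.
- move=> j; rewrite (alpha_of_sub1 j mi) -cf Ef' !forest_cnt_cons forest_cnt_cat /= chain_cnt_kids lc.
  by lia.
rewrite (weight_sub1 mi) -zf Ef' !forest_size_cons forest_size_cat /= chain_size_kids lc; lia.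
Qed.

Lemma forests_complete d m f : mdeg m <= d -> forest_wf f ->
  (forall j, forest_cnt j f = alpha_of m j) -> f \in forests d (size f) m.
Proof.
elim: d m f => [|d IHd] m f; elim: f m => [|[|a c] f IHf] m md.
- move=> _ cf /=; case: eqP => // -[]; apply/mnmP => i.
  by rewrite mnm0E -alpha_of_ord -cf /forest_cnt big_nil.
- move=> wf cf; rewrite /= mem_cat map_f //; apply: IHf => // j.
  by rewrite -cf forest_cnt_cons.
(* In degree zero there is no node, as [m] would have to count its cycle. *)
- move=> _ cf; have := cf (chain_len c).+1; rewrite forest_cnt_cons /= eqxx => e.
  have [|i _ mi] := @alpha_of_out m (chain_len c).+1; first by rewrite -e.
  by have := mdeg_sub1 mi; move: md; case: (mdeg m).
- move=> _ cf /=; case: eqP => // -[]; apply/mnmP => i.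
  by rewrite mnm0E -alpha_of_ord -cf /forest_cnt big_nil.
- move=> wf cf; rewrite /= mem_cat map_f //; apply: IHf => // j.
  by rewrite -cf forest_cnt_cons.
rewrite /forest_wf /= -andbA -andbA => /and4P[c0 wa wc wf] cf.
have := cf (chain_len c).+1; rewrite forest_cnt_cons /= eqxx => e.
have [|i ei mi] := @alpha_of_out m (chain_len c).+1; first by rewrite -e.
have lc : chain_len c = i.+1 by case: ei.
have md' : mdeg (m - U_(i))%MM <= d by rewrite -ltnS (mdeg_sub1 mi).
rewrite mem_cat; apply/orP; right; apply/allpairsPdep.
exists i, (a :: chain_kids c ++ f); split.
- by rewrite mem_filter mi mem_enum.
- have -> : (i.*2 + 3 + size f)%N = size (a :: chain_kids c ++ f).
    by rewrite /= size_cat size_chain_kids lc; lia.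
  apply: IHd => //.
    by rewrite /forest_wf /= all_cat wa -/(forest_wf (chain_kids c)) -chain_wf_kids wc.
  move=> j; apply/eqP; rewrite -(eqn_add2r (j == i.+2)) -(alpha_of_sub1 j mi) -cf.
  by apply/eqP; rewrite !forest_cnt_cons forest_cnt_cat /= chain_cnt_kids lc; lia.
by rewrite -(ungraftK a f c0) lc.
Qed.

(** A graft never starts with a leaf; the length of its root cycle gives [i] back, and [ungraft]
    gives the forest back. *)
Lemma forests_uniq d k m : mdeg m <= d -> uniq (forests d k m).
Proof.
elim: d k m => [|d IHd] k m; elim: k m => [|k IHk] m md.
- by rewrite /=; case: eqP.
- rewrite /= cat_uniq map_inj_uniq ?IHk //; last by move=> ? ? [].
  have -> : [seq i <- enum 'I_N | (m i != 0)%N] = [::] => //.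
  apply/eqP; rewrite -(negbK (_ == _)) -has_filter; apply/negP => /hasP[i _ mi].
  by have := mdeg_sub1 mi; move: md; case: (mdeg m).
- by rewrite /=; case: eqP.
rewrite /= cat_uniq map_inj_uniq ?IHk //; last by move=> ? ? [].
have sz i f : i \in [seq i <- enum 'I_N | (m i != 0)%N] ->
   f \in forests d (i.*2 + 3 + k) (m - U_(i))%MM -> i.*2.+2 < size f.
  rewrite mem_filter => /andP[mi _] /forests_sound[|-> _ _ _]; last by lia.
  by rewrite -ltnS (mdeg_sub1 mi).
apply/and3P; split=> //.
  apply/hasPn => _ /allpairsPdep[i [f [iin fin ->]]].
  have [a [c [g [-> _ _]]]] := graft_inv (sz _ _ iin fin).
  by apply/negP => /mapP[].
apply: allpairs_uniq_dep.
- by rewrite filter_uniq ?enum_uniq.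
- move=> i; rewrite mem_filter => /andP[mi _]; apply: IHd.
  by rewrite -ltnS (mdeg_sub1 mi).
move=> _ _ /allpairsPdep[i [f [iin fin ->]]] /allpairsPdep[i' [f' [iin' fin' ->]]] /= e.
have [a [c [g [eg ef lc]]]] := graft_inv (sz _ _ iin fin).
have [a' [c' [g' [eg' ef' lc']]]] := graft_inv (sz _ _ iin' fin').
have eff : f = f' by rewrite -(graftK (sz _ _ iin fin)) e graftK // sz.
move: e; rewrite eg eg' => -[_ ecc _].
have eii : i = i' by apply: val_inj; move: lc'; rewrite -ecc lc => -[].
by rewrite eff eii.
Qed.

Definition trees m : seq tree := map (head Leaf) (forests (mdeg m) 1 m).

Lemma size_trees m : size (trees m) = nforests 1 m.
Proof. by rewrite size_map. Qed.

Lemma mem_trees m T : T \in trees m -> [/\ tree_wf T,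
  forall j, tree_cnt j T = alpha_of m j & tree_size T = weight m].
Proof.
case/mapP=> f /(forests_sound (leqnn _))[]; case: f => // T' [|//] _ /=.
rewrite /forest_wf /= andbT => wf cf zf ->; split=> //.
- by move=> j; have := cf j; rewrite /forest_cnt big_seq1.
- by move: zf; rewrite /forest_size big_seq1.
Qed.

Lemma trees_complete m T : tree_wf T -> (forall j, tree_cnt j T = alpha_of m j) ->
  T \in trees m.
Proof.
move=> wT cT; apply/mapP; exists [:: T] => //.
apply: (@forests_complete _ _ [:: T]) => //; first by rewrite /forest_wf /= wT.
by move=> j; rewrite /forest_cnt big_seq1.
Qed.

Lemma uniq_trees m : uniq (trees m).
Proof.
rewrite map_inj_in_uniq ?forests_uniq // => f g /(forests_sound (leqnn _))[sf _ _ _].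
move/(forests_sound (leqnn _)) => [sg _ _ _].
by case: f sf => // T [|//] _; case: g sg => // T' [|//] _ /= ->.
Qed.

End Forests.

(** * Equivalence classes and trees *)

Section Transfer.
Local Open Scope group_scope.

Lemma nf_wf_mut (X : finType) :
  (forall T (L : seq X) w, nf T L w -> tree_wf T) /\
  (forall c (L vs : seq X) As Bs, nfc c L vs As Bs -> chain_wf c).
Proof.
apply: nf_mutind => //= [a c x A L vs w As Bs -> _ -> _ ->|
  b a c B v A L vs wb wa As Bs _ -> _ -> _ ->] //.
Qed.

Lemma nf_wf (X : finType) T (L : seq X) w : nf T L w -> tree_wf T.
Proof. exact: (nf_wf_mut X).1. Qed.

Lemma nf_node_inv (X : finType) a c (L : seq X) w : nf (Node a c) L w ->
  exists x A L1 vs wa As Bs, [/\ L = x :: A ++ L1, w = wa ++ As ++ cyc (x :: vs) :: Bs,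
    nf a (x :: A) wa & nfc c L1 vs As Bs].
Proof. by move=> h; inversion h; subst; do 7 eexists; split; eauto. Qed.

Lemma nfc_cons_inv (X : finType) b a c (L vs : seq X) As Bs : nfc (Cons b a c) L vs As Bs ->
  exists B v A L1 vs1 wb wa As1 Bs1,
   [/\ L = B ++ v :: A ++ L1, [/\ vs = v :: vs1, As = wa ++ As1 & Bs = Bs1 ++ wb],
    nf b (B ++ [:: v]) wb, nf a (v :: A) wa & nfc c L1 vs1 As1 Bs1].
Proof. by move=> h; inversion h; subst; do 9 eexists; split; [|split|..]; eauto. Qed.

Lemma nf_size (X : finType) T (L : seq X) w : nf T L w -> size L = (tree_size T).+1.
Proof. exact: (nf_size_mut X).1. Qed.

(** The sizes of the subtrees fix all cuts of the list. *)
Lemma nf_fun_mut (X : finType) :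
  (forall T (L : seq X) w, nf T L w -> forall w', nf T L w' -> w = w') /\
  (forall c (L vs : seq X) As Bs, nfc c L vs As Bs -> forall vs' As' Bs',
     nfc c L vs' As' Bs' -> [/\ vs = vs', As = As' & Bs = Bs']).
Proof.
apply: nf_mutind => [x w' h|a c x A L vs w As Bs _ ha IHa hc IHc w' h|vs' As' Bs' h|
  b a c B v A L vs wb wa As Bs hb IHb ha IHa hc IHc vs' As' Bs' h].
- by inversion h.
- have [y [A' [L' [vs' [wa' [As' [Bs' [[exy e] -> ha' hc']]]]]]]] := nf_node_inv h.
  subst y.
  have sA : size A == size A' by apply/eqP; have := nf_size ha'; rewrite -(nf_size ha) => -[].
  move/eqP: e; rewrite eqseq_cat; last exact/eqP.
  case/andP=> /eqP eA /eqP eL; rewrite -eA in ha'; rewrite -eL in hc'.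
  by have [-> -> ->] := IHc _ _ _ hc'; rewrite (IHa _ ha').
- by inversion h.
have [B' [v' [A' [L' [vs1 [wb' [wa' [As1 [Bs1 [e [-> -> ->] hb' ha' hc']]]]]]]]]] := nfc_cons_inv h.
have sB : size B = size B'.
  by have := nf_size hb'; rewrite -(nf_size hb) !size_cat /= !addn1 => -[].
have sA : size A = size A' by have := nf_size ha'; rewrite -(nf_size ha) => -[].
move/eqP: e; rewrite eqseq_cat // => /andP[/eqP eB]; rewrite eqseq_cons => /andP[/eqP ev].
rewrite eqseq_cat // => /andP[/eqP eA /eqP eL].
rewrite -eB -ev in hb'; rewrite -ev -eA in ha'; rewrite -eL in hc'.
by have [-> -> ->] := IHc _ _ _ hc'; rewrite (IHa _ ha') (IHb _ hb') ev.
Qed.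

Lemma nf_fun (X : finType) T (L : seq X) w w' : nf T L w -> nf T L w' -> w = w'.
Proof. by move=> h; apply: (nf_fun_mut X).1 h _. Qed.

Section Cycles.
Variable X : finType.
Implicit Types (s : {perm X}) (l : seq X) (x : X).

Lemma is_kcycle_supp k s : is_kcycle k s -> 1 < k /\ #|supp s| = k.
Proof.
case/andP=> k2 /existsP[x /andP[/eqP cx /forallP fx]]; split=> //; rewrite -cx.
apply: eq_card => y; rewrite inE; apply/idP/idP => [|yx].
  by apply: contraNT => /(implyP (fx y)).
(* A fixed point in the orbit would reduce the orbit to one point, against [2 <= k]. *)
apply/negP => /eqP sy; move: cx k2; rewrite -eq_porbit_mem in yx.
rewrite -(eqP yx) => <-; have -> : porbit s y = [set y]; last by rewrite cards1.
apply/setP => z; rewrite inE; apply/porbitP/eqP => [[i ->]|->]; last by exists 0%N; rewrite expg0 perm1.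
by elim: i => [|i IH]; rewrite ?expg0 ?perm1 // expgSr permM IH.
Qed.

Lemma is_kcycle_cyc l : uniq l -> 1 < size l -> is_kcycle (size l) (cyc l).
Proof.
case: l => // x l u sl; rewrite /is_kcycle sl /=.
have st y : y \in x :: l -> porbit (cyc (x :: l)) y = porbit (cyc (x :: l)) x.
  apply: const_along => P y' z Q E; have := u; rewrite {1}E => u'.
  have := cyc_step u'; rewrite -E => <-.
  apply/eqP; rewrite eq_porbit_mem porbit_sym.
  by have := mem_porbit (cyc (x :: l)) 1 y'; rewrite expg1.
have px : porbit (cyc (x :: l)) x =i x :: l.
  move=> y; apply/idP/idP => [/porbitP[i ->]|/st <-]; last exact: porbit_id.
  elim: i => [|i IH]; first by rewrite expg0 perm1 mem_head.
  by rewrite expgSr permM cyc_in.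
apply/existsP; exists x; rewrite (eq_card px) (card_uniqP u) eqxx /=.
by apply/forallP => y; apply/implyP; rewrite px => yl; rewrite cyc_out.
Qed.

(** Constant [g = 1] gives the number of factors, [g = predn] the rank; [alpha_sum] evaluates the
    right-hand side for a given type. *)
Lemma rank_count (t : seq {perm X}) B (g : nat -> nat) :
  (forall s, s \in t -> #|supp s| < B) ->
  (\sum_(s <- t) g #|supp s| = \sum_(j < B) count (fun s => #|supp s| == j) t * g j)%N.
Proof.
elim: t => [|s t IH] h; first by rewrite big_nil big1.
rewrite big_cons IH => [|s' s't]; last by apply: h; rewrite inE s't orbT.
under [RHS]eq_bigr do rewrite /= mulnDl.
rewrite big_split /=; congr addn; have sB := h s (mem_head _ _).
rewrite (bigD1 (Ordinal sB)) //= eqxx mul1n big1 ?addn0 // => j.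
by rewrite -val_eqE /= eq_sym => /negPf->.
Qed.

End Cycles.

Lemma alpha_sum N (m : 'X_{1..N}) (g : nat -> nat) :
  (\sum_(j < N.+2) alpha_of m j * g j = \sum_(i < N) m i * g i.+2)%N.
Proof.
rewrite 2!big_ord_recl /= !add0n; apply: eq_bigr => i _.
by rewrite /bump /= !add1n alpha_of_ord.
Qed.

Lemma leq_weight N (m : 'X_{1..N}) (i : 'I_N) : (m i != 0)%N -> i < weight m.
Proof. by move=> mi; rewrite (weight_sub1 mi) addnS ltnS leq_addl. Qed.

Lemma ncycle_cyc n : ncycle n = cyc (enum 'I_n).
Proof.
apply/permP => i; rewrite permE cycE ?enum_uniq // next_nth mem_enum inE.
apply: val_inj; rewrite /= index_enum_ord.
have : size (enum 'I_n) = n by rewrite size_enum_ord.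
case E: (enum 'I_n) => [|x l] sl; first by move: (ltn_ord i); rewrite -[X in i < X]sl.
have x0 : nat_of_ord x = 0%N.
  by rewrite -[x]/(nth i (x :: l) 0) -E nth_enum_ord // (leq_ltn_trans _ (ltn_ord i)).
have [li|li] := ltnP i.+1 n.
  rewrite modn_small // (set_nth_default i).
    by rewrite -[nth i l i]/(nth i (x :: l) i.+1) -E nth_enum_ord.
  by move: sl => /= sl; rewrite -ltnS sl.
rewrite nth_default ?x0; last by move: sl => /= sl; rewrite -ltnS sl.
by have -> : i.+1 = n; [apply/eqP; rewrite eqn_leq li ltn_ord | rewrite modnn].
Qed.

(** * Swaps of adjacent commuting factors in tuples *)

Section Swap.
Variables (n M : nat).
Implicit Types t u : M.-tuple {perm 'I_n}.

Lemma swap_relP t u : reflect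
  (exists k k', [/\ val k' = (val k).+1, commute (tnth t k) (tnth t k') &
     u = [tuple tnth t (tperm k k' i) | i < M]]) (swap_rel t u).
Proof.
apply: (iffP existsP) => [[k /existsP[k' /and3P[/eqP e /eqP c /forallP h]]]|[k [k' [e c ->]]]].
  by exists k, k'; split=> //; apply: eq_from_tnth => i; rewrite tnth_mktuple (eqP (h i)).
exists k; apply/existsP; exists k'; rewrite e c !eqxx /=.
by apply/forallP => i; rewrite tnth_mktuple.
Qed.

Lemma swap_rel_sym : ssrbool.symmetric (@swap_rel n M).
Proof.
suff h t u : swap_rel t u -> swap_rel u t by move=> t u; apply/idP/idP; apply: h.
case/swap_relP=> k [k' [e c ->]]; apply/swap_relP; exists k, k'; split=> //.
  by rewrite !tnth_mktuple tpermL tpermR; apply: esym.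
by apply: eq_from_tnth => i; rewrite !tnth_mktuple tpermK.
Qed.

Lemma connect_swap_perm t u : connect (@swap_rel n M) t u -> perm_eq t u.
Proof.
case/connectP => p; elim: p t => [|v p IH] t /=; first by move=> _ ->.
case/andP=> /swap_relP[k [k' [_ _ ev]]] pv /(IH _ pv); apply: perm_trans.
by rewrite perm_sym; apply/tuple_permP; exists (tperm k k'); rewrite ev.
Qed.

Lemma ceq_connect t u : ceq t u -> connect (@swap_rel n M) t u.
Proof.
move: {2 3}(tval u) (erefl (tval u)) => v + tv; elim: tv u => {v} [|p a b q _ IH ab] u eu.
  by rewrite (val_inj eu) connect0.
have sz : size (p ++ a :: b :: q) == M.
  by rewrite -(size_tuple u) eu !size_cat.
apply: connect_trans (IH (Tuple sz) erefl) (connect1 _).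
have sM : M = (size p + (size q).+2)%N by rewrite -(eqP sz) size_cat.
have kM : size p < M by rewrite sM; lia.
have kM' : (size p).+1 < M by rewrite sM; lia.
apply/swap_relP; exists (Ordinal kM), (Ordinal kM'); split=> //.
  by rewrite !(tnth_nth 1) /= !nth_cat ltnn subnn ltnNge leqnSn /= subSnn.
apply: eq_from_tnth => i; rewrite tnth_mktuple !(tnth_nth 1) /= eu.
case: tpermP => [->|->|].
- by rewrite /= !nth_cat ltnn subnn ltnNge leqnSn /= subSnn.
- by rewrite /= !nth_cat ltnn subnn ltnNge leqnSn /= subSnn.
move=> /eqP; rewrite -val_eqE /= => i1 /eqP; rewrite -val_eqE /= => i2.
have {}i1 : nat_of_ord i != size p := i1; have {}i2 : nat_of_ord i != (size p).+1 := i2.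
rewrite !nth_cat; case: ltnP => // pi.
have ar (j k : nat) : j != k -> j != k.+1 -> k <= j -> (j - k = (j - k.+2).+2)%N by lia.
by rewrite (ar _ _ i1 i2 pi).
Qed.

End Swap.

(** Finite choice by induction on the list; it fixes one factorization per tree. *)
Lemma choice_seq (A : eqType) B (P : A -> B -> Prop) (b0 : B) (s : seq A) :
  (forall a, a \in s -> exists b, P a b) -> exists F, forall a, a \in s -> P a (F a).
Proof.
elim: s => [|a s IH] h; first by exists (fun _ => b0).
have [b Pb] := h a (mem_head _ _).
have [|F hF] := IH; first by move=> a' a's; apply: h; rewrite inE a's orbT.
exists (fun a' => if a' == a then b else F a') => a'; rewrite inE.
by have [->|_ /= /hF] := eqVneq a' a.
Qed.

(** * Bijection between equivalence classes and trees *)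

Section Count.
Variables (N : nat) (m : 'X_{1..N}).
Notation n := (weight m).+1.
Notation M := (mdeg m).
Notation L := (enum 'I_n).

Lemma alpha_of_large j : n < j -> alpha_of m j = 0%N.
Proof.
move=> nj; apply/eqP; apply: contraTT nj => /alpha_of_out[i -> /leq_weight iw].
by rewrite -leqNgt ltnS.
Qed.

Lemma supp_le_n (s : {perm 'I_n}) : #|supp s| <= n.
Proof. by apply: leq_trans (max_card _) _; rewrite card_ord. Qed.

Lemma count_supp_bound (t : seq {perm 'I_n}) :
  (forall j, count (fun s => #|supp s| == j) t = alpha_of m j) ->
  forall s, s \in t -> #|supp s| < N.+2.
Proof.
move=> h s st; have : alpha_of m #|supp s| != 0%N.
  by rewrite -h -lt0n -has_count; apply/hasP; exists s.
by case/alpha_of_out => i -> _; rewrite !ltnS.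
Qed.

(** The length of a cycle is the size of its support, and for [j > n] both counts vanish. *)
Lemma is_fact_count (t : M.-tuple {perm 'I_n}) :
  (forall s, s \in tval t -> exists k, is_kcycle k s) ->
  (forall k : 'I_n.+1, count (is_kcycle k) t = alpha_of m k) <->
  (forall j, count (fun s => #|supp s| == j) t = alpha_of m j).
Proof.
move=> h; have e k : count (is_kcycle k) t = count (fun s => #|supp s| == k) t.
  apply: eq_in_count => s /h[k' hk']; have [_ e'] := is_kcycle_supp hk'.
  apply/idP/eqP => [/is_kcycle_supp[]//|<-]; by rewrite e'.
split=> hc j; last by rewrite e hc.
have [jn|jn] := ltnP j n.+1; first by rewrite -e (hc (Ordinal jn)).
rewrite alpha_of_large //; apply/eqP; rewrite -leqn0 leqNgt -has_count.
apply/hasP => -[s _ /eqP sj]; have := supp_le_n s; rewrite sj; lia.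
Qed.

Lemma is_factP (t : M.-tuple {perm 'I_n}) : reflect
  [/\ \prod_(s <- t) s = cyc L, (forall s, s \in tval t -> exists k, is_kcycle k s) &
    forall j, count (fun s => #|supp s| == j) t = alpha_of m j]
  (is_fact (alpha_of m) t).
Proof.
have eP : \prod_(i < M) tnth t i = \prod_(s <- t) s by rewrite big_tuple.
apply: (iffP and3P) => [[/eqP p /forallP h1 /forallP h2]|[p h1 h2]].
  have h s : s \in tval t -> exists k, is_kcycle k s.
    by case/tnthP=> i ->; have /existsP[k] := h1 i; exists k.
  split=> //; first by rewrite -eP p ncycle_cyc.
  by apply/(is_fact_count h) => k; apply/eqP.
split; first by rewrite eP p ncycle_cyc.
  apply/forallP => i; have [k hk] := h1 _ (mem_tnth i t).
  have [_ e] := is_kcycle_supp hk.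
  have kn : k < n.+1 by rewrite ltnS -e supp_le_n.
  by apply/existsP; exists (Ordinal kn).
by apply/forallP => k; apply/eqP; apply: (is_fact_count h1).2.
Qed.

Lemma nf_is_fact T : T \in trees m ->
  exists t : M.-tuple {perm 'I_n}, nf T L t /\ is_fact (alpha_of m) t.
Proof.
case/mem_trees=> wT cT sT.
have [|w hw] := @nf_ex _ T L wT; first by rewrite size_enum_ord sT.
have uL : uniq L := enum_uniq _.
have cw j : count (fun s => #|supp s| == j) w = alpha_of m j.
  by rewrite (nf_card hw uL) cT.
have sw : size w == M.
  apply/eqP; rewrite -sum1_size (rank_count (fun _ => 1%N) (count_supp_bound cw)).
  under eq_bigr do rewrite cw; rewrite (alpha_sum m (fun _ => 1%N)) mdegE.
  by apply: eq_bigr => i _; rewrite muln1.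
exists (Tuple sw); split=> //; apply/is_factP; split=> //=; first exact: nf_prod hw uL.
by move=> s /(nf_cyc hw uL)[l [ul sl ->]]; exists (size l); apply: is_kcycle_cyc.
Qed.

Lemma is_fact_nf (t : M.-tuple {perm 'I_n}) : is_fact (alpha_of m) t ->
  exists T w, [/\ T \in trees m, nf T L w & ceq t w].
Proof.
case/is_factP=> p h c; have uL : uniq L := enum_uniq _.
have [|||||T [w [hw ew]]] := @minimal_nf _ (size t) L t (leqnn _).
- by rewrite -size_eq0 size_enum_ord.
- exact: uL.
- move=> s /h[k hk]; have [k2 e] := is_kcycle_supp hk; split; first by rewrite e.
  by move=> x _; rewrite mem_enum.
- exact: p.
- rewrite /rank (rank_count predn (count_supp_bound c)) size_enum_ord /=.
  under eq_bigr do rewrite c; rewrite (alpha_sum m predn) /weight.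
  by apply: eq_bigr => i _; rewrite mulnC.
exists T, w; split=> //; apply: trees_complete; first exact: nf_wf hw.
by move=> j; rewrite -(nf_card hw uL) -c; apply/esym/seq.permP; apply: ceq_perm.
Qed.

(** [F] picks the word of each tree. By [is_fact_nf] every class contains some [F T]; equivalent
    tuples have the same factors, so [nf_inj] puts different trees in different classes. *)
Lemma HtildeE : Htilde m = nforests 1 m.
Proof.
rewrite -size_trees /Htilde; set R := connect _; set D := [set t | _].
have uL : uniq L := enum_uniq _.
have [F hF] := choice_seq [tuple of nseq M (1 : {perm 'I_n})] (@nf_is_fact).
have sR : connect_sym (@swap_rel n M) by apply: sym_connect_sym; apply: swap_rel_sym.
have injF T T' : T \in trees m -> T' \in trees m -> R (F T) (F T') -> T = T'.
  move=> hT hT' /connect_swap_perm/perm_mem e.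
  exact: nf_inj uL (hF _ hT).1 (hF _ hT').1 e.
pose cl t := [set u in D | R t u].
have clE t u : R t u -> cl t = cl u.
  by move=> tu; apply/setP => v; rewrite !inE; congr andb; apply: same_connect sR _ _ tu v.
have FD T : T \in trees m -> F T \in D by move=> hT; rewrite inE (hF _ hT).2.
have DF t : t \in D -> exists2 T, T \in trees m & R t (F T).
  rewrite inE => /is_fact_nf[T [w [hT hw ew]]]; exists T => //.
  by apply: ceq_connect; rewrite -(nf_fun hw (hF _ hT).1).
have -> : equivalence_partition R D = [set cl t | t in map F (trees m)].
  apply/setP => A; apply/imsetP/imsetP => -[t tD ->].
    by have [T hT /clE e] := DF _ tD; exists (F T); first exact: map_f.
  by case/mapP: tD => T hT ->; exists (F T); first exact: FD.
rewrite card_in_imset.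
  rewrite (card_uniqP _) ?size_map // map_inj_in_uniq ?uniq_trees // => T T' hT hT' e.
  by apply: injF => //; rewrite e /R connect0.
move=> _ _ /mapP[T hT ->] /mapP[T' hT' ->] e; congr F; apply: injF => //.
have : F T' \in cl (F T') by rewrite inE FD //= /R connect0.
by rewrite -e inE => /andP[].
Qed.

End Count.
End Transfer.

(** * The functional equation and the Catalan numbers *)

Import GRing.Theory Num.Theory.
Local Open Scope ring_scope.

Section Equation.
Variable N : nat.
Implicit Types (m : 'X_{1..N}) (p q : {mpoly int[N]}).

(** Lets truncated polynomials be manipulated like power series. *)
Lemma mcoeffM_congr p p' q m :
  (forall m', (mdeg m' <= mdeg m)%N -> p@_m' = p'@_m') -> (p * q)@_m = (p' * q)@_m.
Proof.
move=> h; rewrite !mcoeffM; apply: eq_bigr => k _.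
by rewrite h // -ltnS bmdeg.
Qed.

Lemma mcoeffXM (i : 'I_N) p m :
  ('X_i * p)@_m = if (m i != 0)%N then p@_(m - U_(i)) else 0.
Proof.
case: ifPn => [mi|/negPn/eqP mi].
  have /submK {1}<- : (U_(i) <= m)%MM by rewrite lep1mP.
  by rewrite mulrC addmC mcoeffMX.
rewrite mcoeffM big1 // => k /eqP em; rewrite mcoeffX.
have [e|_] := eqVneq U_(i)%MM (bmnm k.1); last by rewrite mul0r.
by have := congr1 (fun m' : 'X_{1..N} => m' i) em; rewrite mnmDE -e mnm1E eqxx mi.
Qed.

Variable d : nat.

Definition forest_poly k : {mpoly int[N]} :=
  \sum_(m : 'X_{1..N < d.+1}) (nforests k (bmnm m))%:R *: 'X_[bmnm m].

Lemma mcoeff_forest_poly k m : (mdeg m <= d)%N -> (forest_poly k)@_m = (nforests k m)%:R.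
Proof. by move=> md; rewrite /forest_poly (mcoeff_mpoly (fun m => (nforests k m)%:R)). Qed.

(** Induction on the degree, then on [k]: multiplying the recursion in [k] by the polynomial of [l]
    gives the recursion for [k + l]. The polynomial [q] is the right-hand side of that recursion. *)
Lemma mcoeff_forest_polyM k l m : (mdeg m <= d)%N ->
  (forest_poly k * forest_poly l)@_m = (nforests (k + l) m)%:R.
Proof.
have [n] := ubnP (mdeg m); elim: n k m => // n IHn k m; elim: k => [|k IHk] mn md.
  rewrite (@mcoeffM_congr _ 1) ?mul1r ?mcoeff_forest_poly // => m' mm'.
  by rewrite mcoeff_forest_poly ?nforests0 ?mcoeff1 // (leq_trans mm').
pose q := forest_poly k + \sum_(i < N) 'X_i * forest_poly (i.*2 + 3 + k).
rewrite (@mcoeffM_congr _ q) => [|m' mm'].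
  rewrite mulrDl mcoeffD IHk // addSn nforestsS natrD; congr (_ + _).
  rewrite mulr_suml raddf_sum natr_sum [RHS]big_mkcond /=; apply: eq_bigr => i _.
  rewrite -mulrA mcoeffXM; case: ifP => // mi.
  by rewrite IHn ?addnA //; move: mn md; rewrite -(mdeg_sub1 mi); lia.
have md' := leq_trans mm' md.
rewrite mcoeff_forest_poly // nforestsS mcoeffD mcoeff_forest_poly // natrD; congr (_ + _).
rewrite natr_sum [LHS]big_mkcond [RHS]raddf_sum /=; apply: eq_bigr => i _.
rewrite mcoeffXM; case: ifP => // mi.
by rewrite mcoeff_forest_poly //; move: md'; rewrite -(mdeg_sub1 mi); lia.
Qed.

Lemma xi_truncE : xi_trunc N d = forest_poly 1.
Proof. by apply: eq_bigr => m _; rewrite HtildeE. Qed.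

Lemma mcoeff_xi_exp k m : (mdeg m <= d)%N -> (xi_trunc N d ^+ k)@_m = (nforests k m)%:R.
Proof.
elim: k m => [|k IHk] m md; first by rewrite expr0 mcoeff1 nforests0.
rewrite exprSr xi_truncE (@mcoeffM_congr _ (forest_poly k)) => [|m' mm'].
  by rewrite mcoeff_forest_polyM // addn1.
have md' := leq_trans mm' md.
by rewrite -xi_truncE IHk // mcoeff_forest_poly.
Qed.

(** Since the [k]-th power of [xi] counts forests of [k] trees, this is [nforestsS] at [k = 0].
    Variable [i] is [x_j] with [j = i + 2], so [2 i + 3 = 2 j - 1]. *)
Lemma xi_equation m : (mdeg m <= d)%N ->
  (xi_trunc N d)@_m = (1 + \sum_(i < N) 'X_i * xi_trunc N d ^+ (2 * i + 3))@_m.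
Proof.
move=> md; rewrite -[xi_trunc N d in LHS]expr1 mcoeff_xi_exp // nforestsS natrD.
rewrite mcoeffD mcoeff1 nforests0; congr (_ + _).
rewrite natr_sum [LHS]big_mkcond [RHS]raddf_sum /=; apply: eq_bigr => i _.
rewrite mcoeffXM; case: ifP => // mi.
by rewrite mcoeff_xi_exp ?addn0 ?mul2n //; move: md; rewrite -(mdeg_sub1 mi); lia.
Qed.

End Equation.

(** * Signed counts and ballot numbers *)

Section Catalan.
Variable N : nat.
Implicit Types (m : 'X_{1..N < N.+1}).

(** For [n <= N] every type of weight [n] occurs: its cycles have length at most [n + 1] and its
    degree is at most [n]. Fixing [N] keeps the index set unchanged while [n] decreases. *)
Definition signed_forests k n : rat :=
  \sum_(m : 'X_{1..N < N.+1} | weight (bmnm m) == n)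
     (-1) ^+ (mdeg (bmnm m) + n) * (nforests k (bmnm m))%:R.

Lemma mdeg_le_weight (m : 'X_{1..N}) : (mdeg m <= weight m)%N.
Proof. by rewrite mdegE; apply: leq_sum => i _; rewrite leq_pmull. Qed.

Lemma weightD1 (m : 'X_{1..N}) i : weight (m + U_(i))%MM = (weight m + i.+1)%N.
Proof. by rewrite (@weight_sub1 _ _ i) ?addmK // mnmDE mnm1E eqxx addn1. Qed.

Lemma sum_weight_sub1 (i : 'I_N) n (F : 'X_{1..N} -> rat) : (n <= N)%N ->
  \sum_(m : 'X_{1..N < N.+1} | (weight (bmnm m) == n) && (bmnm m i != 0)%N)
     F (bmnm m - U_(i))%MM =
  if (i < n)%N then \sum_(m : 'X_{1..N < N.+1} | weight (bmnm m) == (n - i.+1)%N) F (bmnm m)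
  else 0.
Proof.
move=> nN; case: ltnP => i_n; last first.
  rewrite big_pred0 // => m; apply/negP => /andP[/eqP wm /leq_weight].
  by rewrite wm ltnNge i_n.
pose add1 m : 'X_{1..N < N.+1} := insubd m (bmnm m + U_(i))%MM.
pose sub1 m : 'X_{1..N < N.+1} := insubd m (bmnm m - U_(i))%MM.
have sub1E m : bmnm (sub1 m) = (bmnm m - U_(i))%MM.
  by apply: insubdK; rewrite -topredE /=; apply: leq_ltn_trans (mdegB _ _) (bmdeg m).
have add1E m : (mdeg (bmnm m) < N)%N -> bmnm (add1 m) = (bmnm m + U_(i))%MM.
  by move=> mN; apply: insubdK; rewrite -topredE /= mdegD mdeg1 addn1 ltnS.
rewrite (reindex_onto add1 sub1) => [|m /andP[wm mi]]; last first.
  apply: val_inj; rewrite /= add1E sub1E; first by rewrite submK // lep1mP.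
  by have := bmdeg m; rewrite -(mdeg_sub1 mi) ltnS.
apply: eq_big => m; last first.
  by case/andP=> _ /eqP e; rewrite -sub1E e.
have [mN|mN] := ltnP (mdeg (bmnm m)) N.
  rewrite add1E // weightD1 mnmDE mnm1E eqxx addn1 /= andbT.
  have -> : sub1 (add1 m) == m by apply/eqP/val_inj; rewrite /= sub1E add1E // addmK.
  by rewrite andbT; apply/eqP/eqP; lia.
(* In degree [N], [add1] falls back on its default [m]. Such an [m] counts on neither side: its
   weight is at least [N], above [n - i - 1], and [sub1] lowers its degree. *)
have -> : add1 m = m.
  by apply: val_inj; rewrite val_insubd mdegD mdeg1 addn1 ltnS ltnNge mN.
have /gtn_eqF-> : (n - i.+1 < weight (bmnm m))%N.
  by apply: leq_trans (mdeg_le_weight _); lia.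
apply/negP => /andP[/andP[_ mi] /eqP/(congr1 (fun m => mdeg (bmnm m)))].
by rewrite sub1E -(mdeg_sub1 mi); lia.
Qed.

(** Removing a root with index [i] lowers the degree by one and the weight by [i + 1], which leaves
    the sign [(-1)^i]. *)
Lemma signed_forestsS k n : (n <= N)%N ->
  signed_forests k.+1 n = signed_forests k n +
    \sum_(i < n) (-1) ^+ i * signed_forests (i.*2 + 3 + k)%N (n - i.+1)%N.
Proof.
move=> nN; rewrite /signed_forests.
under eq_bigr do rewrite nforestsS natrD mulrDr natr_sum mulr_sumr big_mkcond.
rewrite big_split /=; congr (_ + _); rewrite exchange_big /=.
rewrite (big_ord_widen N (fun i => (-1) ^+ i * signed_forests (i.*2 + 3 + k)%N (n - i.+1)%N)) //.
rewrite [RHS]big_mkcond /=; apply: eq_bigr => i _.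
rewrite -big_mkcondr /=.
pose F (m : 'X_{1..N}) : rat := (-1) ^+ ((mdeg m).+1 + n) * (nforests (i.*2 + 3 + k) m)%:R.
rewrite (eq_bigr (fun m : 'X_{1..N < N.+1} => F (bmnm m - U_(i))%MM)); last first.
  by move=> m /andP[_ mi]; rewrite /F (mdeg_sub1 mi).
rewrite sum_weight_sub1 //; case: ltnP => // i_n.
rewrite /signed_forests mulr_sumr; apply: eq_bigr => m _; rewrite /F mulrA -exprD.
congr (_ * _); rewrite -signr_odd -[RHS]signr_odd; congr (_ ^+ nat_of_bool _).
by rewrite !oddD oddB //= addbA; case: (odd _) (odd n) (odd i) => [] [] [].
Qed.

Lemma signed_forests0 n : signed_forests 0 n = (n == 0%N)%:R.
Proof.
have w0 : weight (0%MM : 'X_{1..N}) = 0%N.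
  by rewrite /weight big1 // => i _; rewrite mnm0E muln0.
rewrite /signed_forests; have [->|n0] := eqVneq n 0%N; last first.
  by rewrite big1 // => m /eqP wm; rewrite nforests0; case: eqP => [m0|]; rewrite ?mulr0 //;
     move: n0; rewrite -wm m0 w0.
have z : (mdeg (0%MM : 'X_{1..N}) < N.+1)%N by rewrite mdeg0.
rewrite (bigD1 (Sub 0%MM z)) /= ?w0 // mdeg0 nforests0 eqxx mulr1 big1 ?addr0 // => m /andP[_ m0].
rewrite nforests0; case: eqP => [e|]; rewrite ?mulr0 //.
by case/eqP: m0; apply: val_inj.
Qed.

(** The term [i = 0] is the count for [k + 3] trees and weight [n]; expanding it by
    [signed_forestsS] gives the term for [k + 2] and a sum that cancels the terms with [i > 0]. *)
Lemma signed_forests_rec k n : (n < N)%N ->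
  signed_forests k.+1 n.+1 = signed_forests k n.+1 + signed_forests k.+2 n.
Proof.
move=> nN; rewrite signed_forestsS //; congr (_ + _).
rewrite big_ord_recl /= mul1r subn1 /= add0n add3n signed_forestsS ?(ltnW nN) //.
rewrite -[RHS]addr0 -addrA; congr (_ + _); rewrite -big_split big1 //= => i _.
rewrite /bump /= add1n exprS mulN1r mulNr doubleS subSS.
by rewrite (_ : (i.*2 + 3 + k.+2 = i.*2.+2 + 3 + k)%N) ?subrr //; lia.
Qed.

(** For [n > 0] this is the ballot number [k / (2 n + k) * C(2 n + k, n)]; as a difference of
    binomials it obeys the recursion by Pascal's rule. *)
Lemma signed_forests_bin k n : (n <= N)%N -> signed_forests k n =
  if n is n'.+1 then 'C(n'.*2 + k + 1, n)%:R - 'C(n'.*2 + k + 1, n')%:R else 1.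
Proof.
elim: n k => [|n IHn] k nN.
  elim: k => [|k IHk]; first by rewrite signed_forests0.
  by rewrite signed_forestsS // IHk big_ord0 addr0.
elim: k => [|k IHk].
  (* At [k = 0] the two binomials agree by symmetry. *)
  rewrite signed_forests0 addn0 /= -(@bin_sub (n.*2 + 1) n.+1); last by lia.
  by rewrite (_ : (n.*2 + 1 - n.+1 = n)%N) ?subrr //; lia.
rewrite signed_forests_rec // IHk IHn 1?ltnW //.
case: n {IHn IHk nN} => [|n].
  by rewrite !bin1 !bin0 double0 !add0n !addn1 -!natr1; ring.
rewrite (_ : (n.+1.*2 + k.+1 + 1 = (n.+1.*2 + k + 1).+1)%N); last by lia.
rewrite (_ : (n.*2 + k.+2 + 1 = n.+1.*2 + k + 1)%N); last by lia.
by rewrite !binS !natrD; ring.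
Qed.

End Catalan.

Lemma signed_catalan n :
  \sum_(m : 'X_{1..n < n.+1} | weight (bmnm m) == n)
     (-1) ^+ (mdeg (bmnm m) + n) * (Htilde (bmnm m))%:R = 'C(2 * n, n)%:R / n.+1%:R :> rat.
Proof.
under eq_bigr do rewrite HtildeE.
rewrite -/(signed_forests n 1 n) signed_forests_bin //.
case: n => [|n]; first by rewrite bin0 divr1.
rewrite (_ : (n.*2 + 1 + 1 = 2 * n.+1)%N); last by lia.
(* This says [(n + 1) a = (n + 2) b], whence [(a - b) (n + 2) = a]. *)
have := mul_bin_left (2 * n.+1) n; rewrite (_ : (2 * n.+1 - n = n.+2)%N); last by lia.
move/(congr1 (fun x => x%:R : rat)); rewrite !natrM.
set a := 'C(_, n.+1)%:R; set b := 'C(_, n)%:R => e.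
have n2 : (n.+2%:R : rat) != 0 by rewrite pnatr_eq0.
apply: (mulIf n2); rewrite mulfVK // mulrBl [b * _]mulrC -e.
by rewrite -[n.+2%:R]natr1; ring.
Qed.

Theorem theorem2 :
  (* xi = 1 + sum_{j>=2} x_j xi^(2j-1), coefficientwise: for every
     monomial in finitely many variables x_2..x_{N+1} of degree <= d *)
  (forall (N d : nat) (m : 'X_{1..N}), (mdeg m <= d)%N ->
     (xi_trunc N d)@_m =
     (1 + \sum_(i < N) 'X_i * (xi_trunc N d) ^+ (2 * i + 3))@_m)
  /\
  (* Catalan consequence: sum over alpha with <alpha> = n *)
  (forall n : nat,
     \sum_(m : 'X_{1..n < n.+1} | weight (m : 'X_{1..n}) == n)
        (-1) ^+ (mdeg m + n) * ((Htilde (m : 'X_{1..n}))%:R : rat)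
     = ('C(2 * n, n))%:R / (n.+1)%:R).
Proof.
split; last exact: signed_catalan.
by move=> N d m; apply: xi_equation.
Qed.
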